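(* Let $G$ be a countably infinite group acting by homeomorphisms on a compact metrizable space $X$, and let $G\curvearrowright \mathcal{M}(X)$ be the induced action by push-forwards on the space $\mathcal{M}(X)$ of Borel probability measures on $X$ with the weak$^*$-topology. Then the following are equivalent: \begin{enumerate} \item $h_{\mathrm{top}}^{*}(G\curvearrowright X)>0$; \item $h_{\mathrm{top}}^{*}(G\curvearrowright \mathcal{M}(X))>0$; \item $h_{\mathrm{top}}^{*}(G\curvearrowright \mathcal{M}(X))=\infty$. \end{enumerate}
   Context: Covers and sequence entropy: let $G\curvearrowright Z$ be an action of $G$ by homeomorphisms on a compact metrizable space $Z$. For finite open covers $\mathcal{U},\mathcal{V}$ of $Z$, the join is $\mathcal{U}\vee\mathcal{V}=\{U\cap V: U\in\mathcal{U}, V\in\mathcal{V}\}$; for $g\in G$, $g\,\mathcal{U}=\{gU: U\in\mathcal{U}\}$; and $N(\mathcal{U})$ is the smallest cardinality of a subcover of $\mathcal{U}$. For a sequence $S=\{s_n\}_{n\in\mathbb{N}}$ in $G$ (with $\mathbb{N}$ the set of positive integers) and a finite open cover $\mathcal{U}$ of $Z$, define $$h_{\mathrm{top}}(G\curvearrowright Z,\mathcal{U};S)=\limsup_{n\to\infty}\frac1n\log N\Big(\bigvee_{i=1}^n s_i^{-1}\mathcal{U}\Big)\in[0,\infty),$$ and $$h_{\mathrm{top}}^{*}(G\curvearrowright Z)=\sup_{\mathcal{U},S}h_{\mathrm{top}}(G\curvearrowright Z,\mathcal{U};S)\in[0,\infty],$$ where the supremum is over all finite open covers $\mathcal{U}$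 of $Z$ and all sequences $S$ in $G$. Induced action: the weak$^*$-topology on $\mathcal{M}(X)$ is the smallest topology making $\mu\mapsto\int_X f\,d\mu$ continuous for every continuous $f:X\to\mathbb{R}$; with it $\mathcal{M}(X)$ is compact and metrizable. The action $G\curvearrowright\mathcal{M}(X)$ is given by push-forward: $(g\mu)(A)=\mu(g^{-1}A)$ for $g\in G$, $\mu\in\mathcal{M}(X)$ and $A\subset X$ Borel. *)

(* Defs.v *)
From HB Require Import structures.
From mathcomp Require Import all_boot all_order all_algebra.
From mathcomp Require Import all_classical all_reals all_analysis.
From mathcomp Require Import measurable_realfun.
Import Order.TTheory GRing.Theory Num.Theory.
Import numFieldNormedType.Exports.

Set Implicit Arguments.
Unset Strict Implicit.
Unset Printing Implicit Defensive.

Local Open Scope classical_set_scope.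
Local Open Scope ring_scope.

Definition metrizable (R : realType) (T : topologicalType) : Prop :=
  exists d : T -> T -> R,
    [/\ forall x y, 0 <= d x y,
        forall x y, d x y = 0 <-> x = y,
        forall x y, d x y = d y x,
        forall x y z, d x z <= d x y + d y z
      & forall (x : T) (A : set T),
          nbhs x A <-> exists2 e : R, 0 < e & [set y | d x y < e] `<=` A].

(* Each [act g] is a homeomorphism: its inverse [act g^-1] is continuous too. *)
Record action (G : groupType) (Z : topologicalType) := Action {
  act :> G -> Z -> Z;
  act1 : forall x, act 1%g x = x;
  actM : forall g h x, act (g * h)%g x = act g (act h x);
  act_continuous : forall g, continuous (act g) }.

Section sequence_entropy.
Variables (R : realType) (G : groupType) (Z : topologicalType).
Implicit Types (U V : set (set Z)) (a : action G Z) (s : nat -> G).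

Definition finite_open_cover U : Prop :=
  [/\ finite_set U, forall A, U A -> open A & \bigcup_(A in U) A = [set: Z]].

Definition cover_join U V : set (set Z) := [set A `&` B | A in U & B in V].

Definition cover_translate a (g : G) U : set (set Z) :=
  [set a g @` A | A in U].

Definition has_subcover_of_card U (n : nat) : Prop :=
  exists V, [/\ V `<=` U, \bigcup_(A in V) A = [set: Z] & (V #= `I_n)%card].

(* The default value 0 is only taken when [U] has no finite subcover. *)
Definition cover_number U : nat :=
  xget 0%N [set n | has_subcover_of_card U n /\
    forall m, has_subcover_of_card U m -> (n <= m)%N].

(* The trivial cover [{Z}] is neutral for the join. Sequences are indexed from
   1, so that [s 0] is not used. *)
Definition iterated_join a U s (n : nat) : set (set Z) :=
  \big[cover_join/[set [set: Z]]]_(1 <= i < n.+1)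
    cover_translate a (s i)^-1%g U.

Definition htop_seq a U s : \bar R :=
  limn_esup (fun n : nat =>
    (n%:R^-1 * ln (cover_number (iterated_join a U s n))%:R)%:E).

Definition htop_star a : \bar R :=
  ereal_sup [set htop_seq a U s | U in finite_open_cover & s in [set: nat -> G]].

End sequence_entropy.

Section weak_star.
Variables (R : realType) (X : ptopologicalType).
Local Notation B := (g_sigma_algebraType (@open X)).

(* A library measure is a function on all sets, constrained only on measurable
   ones. Fixing the value 0 on the other sets makes the elements of [borel_prob]
   correspond bijectively to the Borel probability measures. *)
Record borel_prob := BorelProb {
  borel_prob_val :> probability B R;
  borel_prob_out : forall A : set B, ~ measurable A -> borel_prob_val A = 0%E }.

Lemma borel_prob_eq (mu nu : borel_prob) :
  (forall A : set B, mu A = nu A) -> mu = nu.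
Proof.
case: mu nu => [mu mu0] [nu nu0] /= /funext munu.
have e : mu = nu.
  case: mu nu munu {mu0 nu0} => f cf [h ch] /= fh.
  case: h / fh ch => ch; congr Probability.Pack.
  destruct cf as [[m1 m2] [m4] [m5] [m6] [m7] [m8] [m9]].
  destruct ch as [[n1 n2] [n4] [n5] [n6] [n7] [n8] [n9]].
  have ? := Prop_irrelevance m1 n1; have ? := Prop_irrelevance m2 n2.
  subst n1 n2.
  by f_equal; f_equal; exact: Prop_irrelevance.
by case: nu / e nu0 {munu} => nu0; congr BorelProb; exact: Prop_irrelevance.
Qed.

HB.instance Definition _ := gen_eqMixin borel_prob.
HB.instance Definition _ := gen_choiceMixin borel_prob.

Definition mean (f : X -> R) (mu : borel_prob) : R :=
  \int[borel_prob_val mu]_x f x.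

(* The coarsest topology making [mean f] continuous for each continuous [f]. *)
HB.instance Definition _ := Topological.copy borel_prob
  (sup_topology (fun f : {f : X -> R | continuous f} =>
    Topological.on (initial_topology (mean (sval f))))).

Lemma mean_continuous (f : X -> R) : continuous f -> continuous (mean f).
Proof.
move=> cf mu A nA; have /cvg_sup/(_ (exist _ f cf)) : nbhs mu --> mu by [].
by apply; exact: (@initial_continuous _ _ (mean f) mu).
Qed.

End weak_star.

Section induced_action.
Variables (R : realType) (G : groupType) (X : ptopologicalType).
Variable a : action G X.
Local Notation B := (g_sigma_algebraType (@open X)).

Lemma act_measurable g : measurable_fun [set: B] (a g : B -> B).
Proof.
apply: (@measurability _ _ B B setT (a g) (@open X)) => // _ [A oA <-].
rewrite setTI; apply: sub_sigma_algebra.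
by move: A oA; apply/continuousP/act_continuous.
Qed.

HB.instance Definition _ g :=
  isMeasurableFun.Build _ _ B B (a g : B -> B) (act_measurable g).

Lemma pushforward_out g (mu : borel_prob R X) (A : set B) : ~ measurable A ->
  distribution mu (a g : {mfun B >-> B}) A = 0%E.
Proof.
move=> mA; apply: borel_prob_out => mgA; apply: mA.
have -> : A = (a g^-1%g : B -> B) @^-1` ((a g : B -> B) @^-1` A).
  by apply/funext => x; rewrite /preimage/= -actM mulgV act1.
by rewrite -[X in measurable X]setTI; exact: act_measurable.
Qed.

(* [(g mu)(A) = mu (a g @^-1` A)], and [a g @^-1` A] is [a g^-1 @` A]. *)
Definition pushforward_fun (g : G) (mu : borel_prob R X) : borel_prob R X :=
  BorelProb (@pushforward_out g mu).

Lemma pushforward_fun1 mu : pushforward_fun 1%g mu = mu.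
Proof.
apply: borel_prob_eq => A; rewrite /= /distribution /pushforward.
by congr (mu _); apply/funext => x; rewrite /preimage/= act1.
Qed.

Lemma pushforward_funM g h mu :
  pushforward_fun (g * h)%g mu = pushforward_fun g (pushforward_fun h mu).
Proof.
apply: borel_prob_eq => A; rewrite /= /distribution /pushforward.
by congr (mu _); apply/funext => x; rewrite /preimage/= actM.
Qed.

Lemma continuous_borel_measurable (f : X -> R) :
  continuous f -> measurable_fun [set: B] (f : B -> R).
Proof.
move=> /continuousP cf; apply: (measurability _ (RGenOpens.measurableE R)).
move=> _ [_ [x [y ->]] <-]; rewrite setTI; apply: sub_sigma_algebra.
exact/cf/interval_open.
Qed.

Lemma mean_pushforward g mu (f : X -> R) : continuous f ->
  mean f (pushforward_fun g mu) = mean (f \o a g) mu.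
Proof.
move=> cf; rewrite /mean /Rintegral; congr fine.
have mf : measurable_fun [set: B] (fun x : B => (f x)%:E).
  by apply/measurable_EFinP; exact: continuous_borel_measurable.
rewrite integralE [in RHS]integralE.
congr (_ - _)%E; rewrite (ge0_integral_pushforward (act_measurable g)) //.
- by rewrite preimage_setT; apply: eq_integral => x _; rewrite /= !funeposE.
- exact: measurable_funepos.
- by rewrite preimage_setT; apply: eq_integral => x _; rewrite /= !funenegE.
- exact: measurable_funeneg.
Qed.

Lemma pushforward_fun_continuous g : continuous (pushforward_fun g).
Proof.
move=> mu; have ? : Filter (nbhs mu) by exact: nbhs_filter.
have ? : Filter (pushforward_fun g @ mu) by apply: fmap_filter.
apply/cvg_sup => -[f cf] /= A.
rewrite (@nbhsE (initial_topology (mean f))) => -[_ [[C oC <-] Cgmu]] CA.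
suff : nbhs mu (mean (f \o a g) @^-1` C).
  by apply: filterS => nu; rewrite /= -mean_pushforward// => Cnu; exact: CA.
apply: mean_continuous.
  by move=> x; apply: continuous_comp; [exact: act_continuous|exact: cf].
by apply: open_nbhs_nbhs; split => //; rewrite -mean_pushforward.
Qed.

Definition pushforward_action : action G (borel_prob R X) :=
  Action pushforward_fun1 pushforward_funM pushforward_fun_continuous.

End induced_action.

(* Main.v *)
Require Import Defs.
From HB Require Import structures.
From mathcomp Require Import all_boot all_order all_algebra.
From mathcomp Require Import all_classical all_reals all_analysis.
From mathcomp Require Import measurable_realfun ring lra.
Import Order.TTheory GRing.Theory Num.Theory.
Import numFieldNormedType.Exports.

(** Positivity of the entropy along a fixed sequence S passes from X to M(X) and
back.

From X to M(X) (Bauer-Sigmund): if N points of X are pairwise separated along S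
by a finite family of test functions, the N^k mixtures of k of their Dirac
masses, with fixed rapidly decreasing weights, are pairwise separated by the
integrals of these functions. So the entropy of M(X) along S is at least k times
that of X, for every k.

From M(X) to X (a theorem of Glasner and Weiss, here through Maurey's empirical
method): the vector of the integrals of the test functions along s_1, ..., s_n
is, up to a mean square error O(1/k), the average of the orbit vectors of k
points of X. Hence it is determined up to a fixed error by the k members of the
join over X containing these points, and by its discretised values at the few
coordinates where the error is large. If the join over X has e^(o(n)) members,
the number of such codes has an arbitrarily small exponential rate.

Both directions use the compactness of M(X). Along an ultrafilter, the pointwise
limit nu of the measures is a finitely additive content; its inner
regularisation on open sets induces a Borel measure m with nu K <= m K for
closed K, and this inequality implies weak* convergence to m. *)

Set Implicit Arguments.
Unset Strict Implicit.
Unset Printing Implicit Defensive.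

Local Open Scope classical_set_scope.
Local Open Scope ring_scope.

(** * Covers *)

Lemma card_finType (T : finType) : ([set: T] #= `I_#|T|)%card.
Proof.
have e : enum_rank @` [set: T] = [set: 'I_#|T|].
  by rewrite -subTset => i _; exists (enum_val i) => //; rewrite enum_valK.
have := @card_II #|T|; rewrite -e => /card_eq_trans h.
rewrite card_eq_sym; apply: h.
by apply: inj_card_eq => x y _ _; exact: enum_rank_inj.
Qed.

Section covers.
Context {Z : topologicalType}.
Implicit Types U V : set (set Z).

Lemma cover_numberP U n : has_subcover_of_card U n ->
  has_subcover_of_card U (cover_number U) /\ (cover_number U <= n)%N.
Proof.
move=> Un.
have exU : exists n, `[< has_subcover_of_card U n >] by exists n; apply/asboolP.
have [m /asboolP Um mmin] := ex_minnP exU.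
have [] : [set n | has_subcover_of_card U n /\
    forall m, has_subcover_of_card U m -> (n <= m)%N] (cover_number U).
  by apply: (xgetI _ (x := m)); split=> // p Up; apply: mmin; apply/asboolP.
by move=> ? h; split=> //; exact: h.
Qed.

(** Choosing for each [t] a member of [U] containing [c t] gives a subcover indexed by [T]. The sets
    [c t] need not be open, so they may consist of the measures sharing a code. *)
Lemma cover_number_le U (T : finType) (c : T -> set Z) :
    (forall t, exists2 A, U A & c t `<=` A) -> (forall z, exists t, c t z) ->
  (cover_number U <= #|T|)%N.
Proof.
move=> cU cZ.
have /choice[A UA] : forall t, exists A, U A /\ c t `<=` A.
  by move=> t; have [A ? ?] := cU t; exists A.
have finA : finite_set (range A) by apply: finite_image; exact: finite_finset.
have [n An] := finA.
have Un : has_subcover_of_card U n.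
  exists (range A); split => //; first by move=> _ [t _ <-]; exact: (UA t).1.
  rewrite -subTset => z _; have [t ctz] := cZ z.
  by exists (A t); [exists t|exact: (UA t).2].
apply: (leq_trans (cover_numberP Un).2).
rewrite -card_le_II -(card_le_eql An) -(card_le_eqr (card_finType T)).
exact: card_image_le.
Qed.

(** Sending [t] to a member of a minimal subcover that contains [z t] is injective. *)
Lemma cover_number_ge U (T : finType) (z : T -> Z) :
    finite_set U -> \bigcup_(A in U) A = [set: Z] ->
    (forall A t t', U A -> A (z t) -> A (z t') -> t = t') ->
  (#|T| <= cover_number U)%N.
Proof.
move=> [n Un] UZ zinj.
have {}Un : has_subcover_of_card U n.
  by exists U; split => //; exact: subset_refl.
have [V [VU VZ Vn]] := (cover_numberP Un).1.
have /choice[A AV] : forall t, exists A, V A /\ A (z t).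
  by move=> t; have : [set: Z] (z t) by []; rewrite -VZ => -[A ? ?]; exists A.
rewrite -card_le_II -(card_le_eqr Vn) -(card_le_eql (card_finType T)).
have Ainj : {in [set: T] &, injective A}.
  move=> t t' _ _ Att; apply: (zinj (A t)).
  - by apply: VU; exact: (AV t).1.
  - exact: (AV t).2.
  - by rewrite Att; exact: (AV t').2.
rewrite -(card_le_eql (inj_card_eq Ainj)).
by apply: subset_card_le => _ [t _ <-]; exact: (AV t).1.
Qed.

Lemma cover_number_gt0 U : Z -> finite_set U -> \bigcup_(A in U) A = [set: Z] ->
  (0 < cover_number U)%N.
Proof.
move=> z Uf UZ; rewrite -card_unit.
by apply: (@cover_number_ge _ _ (fun=> z)) => // A [] [].
Qed.

Lemma cover_numberE U : finite_set U -> \bigcup_(A in U) A = [set: Z] ->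
  exists2 c : 'I_(cover_number U) -> set Z, forall t, U (c t) &
    forall z, exists t, c t z.
Proof.
move=> [n Un] UZ; have {}Un : has_subcover_of_card U n.
  by exists U; split => //; exact: subset_refl.
have [V [VU VZ Vn]] := (cover_numberP Un).1; set m := cover_number U in Vn *.
have /card_set_bijP[c [cV _ Vc]] : (`I_m #= V)%card by rewrite card_eq_sym.
exists c => [t|z]; first by apply: VU; apply: cV; exact: ltn_ord.
have : [set: Z] z by []; rewrite -VZ => -[_ /Vc[i im <-] cz].
by exists (Ordinal im).
Qed.

Lemma cover_joinA : associative (@cover_join Z).
Proof.
move=> U V W; apply/seteqP; split.
  move=> _ [A UA [_ [B VB [C WC <-]] <-]].
  by exists (A `&` B); [exists A => //; exists B|exists C => //; rewrite setIA].
move=> _ [_ [A UA [B VB <-]] [C WC <-]].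
by exists A => //; exists (B `&` C); [exists B => //; exists C|rewrite setIA].
Qed.

Lemma cover_join1l : left_id [set [set: Z]] (@cover_join Z).
Proof.
move=> U; apply/seteqP; split.
  by move=> _ [_ -> [A UA <-]]; rewrite setTI.
by move=> A UA; exists [set: Z] => //; exists A => //; rewrite setTI.
Qed.

Lemma cover_join1r : right_id [set [set: Z]] (@cover_join Z).
Proof.
move=> U; apply/seteqP; split.
  by move=> _ [A UA [_ -> <-]]; rewrite setIT.
by move=> A UA; exists A => //; exists [set: Z] => //; rewrite setIT.
Qed.

HB.instance Definition _ := Monoid.isLaw.Build _ _ (@cover_join Z)
  cover_joinA cover_join1l cover_join1r.

Context {G : groupType} (a : action G Z).

Lemma cover_translateE g U :
  cover_translate a g^-1%g U = [set a g @^-1` A | A in U].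
Proof.
rewrite /cover_translate; congr image; apply/funext => A.
apply/seteqP; split=> [_ [x Ax <-]|x Ax] /=.
  by rewrite /preimage/= -actM mulgV act1.
by exists (a g x) => //; rewrite -actM mulVg act1.
Qed.

Lemma iterated_joinS U s n : iterated_join a U s n.+1 =
  cover_join (iterated_join a U s n) (cover_translate a (s n.+1)^-1%g U).
Proof. by rewrite /iterated_join big_nat_recr. Qed.

Lemma iterated_joinP U s n A : iterated_join a U s n A <->
  exists2 B : nat -> set Z, (forall i, (0 < i <= n)%N -> U (B i)) &
    A = [set z | forall i, (0 < i <= n)%N -> B i (a (s i) z)].
Proof.
elim: n A => [|n ih] A.
  rewrite /iterated_join big_geq//; split=> [->|[B _ ->]].
    exists (fun=> set0); first by case.
    by apply/seteqP; split => // z _ [].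
  by apply/seteqP; split => // z _ [].
rewrite iterated_joinS; split.
  move=> [C /ih[B UB ->]]; rewrite cover_translateE => -[_ [D UD <-] <-].
  exists (fun i => if i == n.+1 then D else B i).
    by move=> i; case: ifPn => // inS /andP[i0];
      rewrite leq_eqVlt (negbTE inS) ltnS /= => ?; apply: UB; rewrite i0.
  apply/seteqP; split => z /=.
    move=> [Bz Dz] i; case: ifPn => [/eqP -> //|inS /andP[i0]].
    by rewrite leq_eqVlt (negbTE inS) ltnS /= => ?; apply: Bz; rewrite i0.
  move=> h; split; last by have := h n.+1; rewrite eqxx; apply; rewrite leqnn.
  move=> i /andP[i0 iin]; have := h i; rewrite ltn_eqF ?ltnS//; apply.
  by rewrite i0 leqW.
move=> [B UB ->].
exists [set z | forall i, (0 < i <= n)%N -> B i (a (s i) z)].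
  by apply/ih; exists B => // i /andP[? ?]; apply: UB; apply/andP; split=> //;
    exact: leqW.
exists (a (s n.+1) @^-1` B n.+1).
  by rewrite cover_translateE; exists (B n.+1) => //; apply: UB; rewrite leqnn.
apply/seteqP; split => z /=.
  move=> [Bz Dz] i /andP[i0]; rewrite leq_eqVlt => /predU1P[-> //|].
  by rewrite ltnS => ?; apply: Bz; rewrite i0.
move=> h; split; last by apply: h; rewrite leqnn.
by move=> i /andP[? ?]; apply: h; apply/andP; split=> //; exact: leqW.
Qed.

Lemma iterated_join_finite U s n : finite_set U ->
  finite_set (iterated_join a U s n).
Proof.
move=> Uf; elim: n => [|n ih].
  by rewrite /iterated_join big_geq//; exact: finite_set1.
by rewrite iterated_joinS; apply: finite_image2 => //; exact: finite_image.
Qed.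

Lemma iterated_join_cover U s n : \bigcup_(A in U) A = [set: Z] ->
  \bigcup_(A in iterated_join a U s n) A = [set: Z].
Proof.
move=> UZ; rewrite -subTset => z _.
have /choice[B UB] : forall i, exists B, U B /\ B (a (s i) z).
  by move=> i; have : [set: Z] (a (s i) z) by []; rewrite -UZ => -[B]; exists B.
exists [set z | forall i, (0 < i <= n)%N -> B i (a (s i) z)].
  by apply/iterated_joinP; exists B => // i _; exact: (UB i).1.
by move=> i _; exact: (UB i).2.
Qed.

End covers.

(** * Integrals of continuous functions *)

Section borel_extension.
Context {R : realType} {X : ptopologicalType}.
Local Notation B := (g_sigma_algebraType (@open X)).
Variable m : set B -> \bar R.
Hypothesis m0 : m set0 = 0%E.
Hypothesis m_ge0 : forall A, (0 <= m A)%E.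
Hypothesis m_sigma_additive : semi_sigma_additive m.
Hypothesis m1 : m [set: B] = 1%E.

(** The value 0 off the Borel sets is the normalisation that [borel_prob] imposes. *)
Definition borel_restrict (A : set B) : \bar R :=
  if `[< measurable A >] then m A else 0%E.

Lemma borel_restrictE A : measurable A -> borel_restrict A = m A.
Proof. by move=> mA; rewrite /borel_restrict asboolT. Qed.

Let borel_restrict0 : borel_restrict set0 = 0%E.
Proof. by rewrite borel_restrictE. Qed.

Let borel_restrict_ge0 A : (0 <= borel_restrict A)%E.
Proof. by rewrite /borel_restrict; case: ifP. Qed.

Let borel_restrict_sigma_additive : semi_sigma_additive borel_restrict.
Proof.
move=> F mF tF mUF; rewrite borel_restrictE//.
rewrite (_ : (fun n => _) = (fun n => \sum_(0 <= i < n) m (F i))%E).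
  exact: m_sigma_additive.
by apply/funext => n; apply: eq_bigr => i _; rewrite borel_restrictE.
Qed.

HB.instance Definition _ := isMeasure.Build _ _ _ borel_restrict
  borel_restrict0 borel_restrict_ge0 borel_restrict_sigma_additive.

Let borel_restrictT : borel_restrict [set: B] = 1%E.
Proof. by rewrite borel_restrictE. Qed.

HB.instance Definition _ := Measure_isProbability.Build _ _ _ borel_restrict
  borel_restrictT.

Lemma borel_prob_exists : exists mu : borel_prob R X,
  forall A, measurable A -> mu A = m A.
Proof.
have out A : ~ measurable A -> borel_restrict A = 0%E.
  by move=> mA; rewrite /borel_restrict asboolF.
by exists (BorelProb out) => A /borel_restrictE.
Qed.

End borel_extension.

Section mean_theory.
Context {R : realType} {X : ptopologicalType}.
Hypothesis Xcompact : compact [set: X].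
Local Notation B := (g_sigma_algebraType (@open X)).
Implicit Types (mu : borel_prob R X) (f g : X -> R).

Lemma continuous_bounded f : continuous f -> exists M, forall x, `|f x| <= M.
Proof.
move=> cf; have : bounded_set (range f).
  apply/compact_bounded/continuous_compact; last exact: Xcompact.
  exact: continuous_subspaceT.
by move=> /ex_strict_bound_gt0[M _ fM]; exists M => x; apply/ltW/fM; exists x.
Qed.

Lemma integrable_continuous mu f : continuous f ->
  mu.-integrable [set: B] (EFin \o (f : B -> R)).
Proof.
move=> cf; apply: measurable_bounded_integrable => //.
- by apply: (le_lt_trans (probability_le1 mu measurableT)); rewrite ltry.
- exact: continuous_borel_measurable.
- have [M fM] := continuous_bounded cf.
  exists M; split; first exact: num_real.
  by move=> N MN x _; apply: (le_trans (fM x)); exact: ltW.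
Qed.

Lemma mean_cst mu c : mean (fun=> c) mu = c.
Proof. rewrite /mean Rintegral_cst//.
by have /(congr1 fine) := probability_setT mu; rewrite /= => ->;
  rewrite mulr1. Qed.

Lemma meanD mu f g : continuous f -> continuous g ->
  mean (fun x => f x + g x) mu = mean f mu + mean g mu.
Proof. by move=> cf cg; rewrite /mean RintegralD//;
  exact: integrable_continuous. Qed.

Lemma meanB mu f g : continuous f -> continuous g ->
  mean (fun x => f x - g x) mu = mean f mu - mean g mu.
Proof. by move=> cf cg; rewrite /mean RintegralB//;
  exact: integrable_continuous. Qed.

Lemma meanZ mu c f : continuous f ->
  mean (fun x => c * f x) mu = c * mean f mu.
Proof. by move=> cf; rewrite /mean RintegralZl//;
  exact: integrable_continuous. Qed.

Lemma le_mean mu f g : continuous f -> continuous g -> (forall x, f x <= g x) ->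
  mean f mu <= mean g mu.
Proof. by move=> cf cg fg; rewrite /mean le_Rintegral//;
  exact: integrable_continuous. Qed.

Lemma mean_sum mu (I : finType) (f : I -> X -> R) :
  (forall i, continuous (f i)) ->
  mean (fun x => \sum_i f i x) mu = \sum_i mean (f i) mu.
Proof.
move=> cf; suff h : forall s : seq I,
    continuous (fun x => \sum_(i <- s) f i x) /\
    mean (fun x => \sum_(i <- s) f i x) mu = \sum_(i <- s) mean (f i) mu.
  by have [] := h (index_enum I).
elim=> [|i s [cs ih]].
  under eq_fun do rewrite big_nil.
  by rewrite big_nil mean_cst; split=> // x; exact: cst_continuous.
under eq_fun do rewrite big_cons.
rewrite big_cons meanD// ih; split=> // x.
by apply: continuousD; [exact: cf|exact: cs].
Qed.

Lemma mean_bound mu f M : continuous f -> (forall x, `|f x| <= M) ->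
  `|mean f mu| <= M.
Proof.
move=> cf fM; rewrite ler_norml -(mean_cst mu (- M)) -[X in _ && (_ <=
  X)](mean_cst mu M).
by apply/andP; split; apply: le_mean => //; do ?[by move=> x;
  exact: cst_continuous];
  move=> x; have := fM x; rewrite ler_norml => /andP[].
Qed.

Lemma exists_le_mean mu f : continuous f -> exists x, f x <= mean f mu.
Proof.
move=> cf.
have X0 : [set: X] !=set0 by exists point.
have [x _ fx] := compact_EVT_min X0 Xcompact (continuous_subspaceT cf).
exists x; rewrite -[leLHS](mean_cst mu); apply: le_mean => //.
  by move=> y; exact: cst_continuous.
by move=> y; apply: fx; rewrite inE.
Qed.

(** The measure is the convex combination [(1 - t) mu + t delta_x], with which the mixtures are
    built one Dirac mass at a time. *)
Lemma mean_dirac_mixture (t : R) mu x : 0 <= t <= 1 ->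
  exists nu : borel_prob R X, forall f, continuous f ->
    mean f nu = (1 - t) * mean f mu + t * f x.
Proof.
move=> /andP[t0 t1].
have t0' : 0 <= 1 - t by rewrite subr_ge0.
pose m : {measure set B -> \bar R} := measure_add (mscale (NngNum t0') mu)
  (mscale (NngNum t0) (dirac (x : B))).
have mE A : m A = ((1 - t)%:E * mu A + t%:E * \d_(x : B) A)%E.
  exact: measure_addE.
have mT : m [set: B] = 1%E.
  have muT : mu [set: B] = 1%E by exact: probability_setT.
  by rewrite mE muT diracT !mule1 -EFinD subrK.
have [nu nuE] := borel_prob_exists (measure0 m) (measure_ge0 m)
  (@measure_semi_sigma_additive _ _ _ m) mT.
exists nu => f cf.
(* The integral formulas used below for sums and multiples of measures are for non-negative
   functions, hence the shift of [f] by a bound [M]. *)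
have [M fM] := continuous_bounded cf.
have fM0 y : 0 <= f y + M.
  by have := fM y; rewrite ler_norml => /andP[+ _]; rewrite -lerBlDr sub0r.
have cM : continuous (fun _ : X => M) by move=> y; exact: cst_continuous.
have cfM : continuous (fun y => f y + M).
  by move=> y; apply: continuousD; [exact: cf|exact: cM].
have mfM : measurable_fun [set: B] (fun y : B => (f y + M)%:E).
  by apply/measurable_EFinP; exact: continuous_borel_measurable.
have : mean (fun y => f y + M) nu = (1 - t) * mean (fun y =>
  f y + M) mu + t * (f x + M).
  rewrite /mean /Rintegral (@eq_measure_integral _ _ _ _ m); last first.
    by move=> A mA _; exact: nuE.
  rewrite ge0_integral_measure_add//; last by move=> y _; rewrite lee_fin.
  rewrite !ge0_integral_mscale//; try by move=> y _; rewrite lee_fin.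
  rewrite integral_dirac// diracT mul1e/=.
  have := integrable_fin_num measurableT (integrable_continuous mu cfM).
  by move=> /fineK <-; rewrite -!EFinM -EFinD.
rewrite !meanD// !mean_cst mulrDr mulrDr => e.
apply: (addIr M); rewrite e.
by rewrite addrACA -mulrDl subrK mul1r.
Qed.

End mean_theory.

(** * Weak* compactness *)

Lemma ultra_fmap (T U : Type) (f : T -> U) (F : set_system T) :
  UltraFilter F -> UltraFilter (f @ F).
Proof.
move=> UF; split; first exact: fmap_proper_filter.
move=> G GP FG; apply/seteqP; split => // A GA.
have [//|FnA] := in_ultra_setVsetC (f @^-1` A) UF.
have : G (A `&` ~` A) by apply: filterI => //; exact: FG.
by rewrite setICr => /filter_not_empty.
Qed.

(** The image ultrafilter contains the compact segment from [- M] to [M]. *)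
Lemma ultra_bounded_cvg (R : realType) (T : Type) (u : T -> R) (M : R)
    (F : set_system T) :
  UltraFilter F -> (forall t, `|u t| <= M) -> cvg (u @ F).
Proof.
move=> UF uM; have := @segment_compact R (- M) M; rewrite compact_ultra.
have uFM : (u @ F) [set` `[- M, M]].
  apply: (@filterE _ F) => t.
  by rewrite /= in_itv/= -ler_norml; exact: uM.
by move=> /(_ _ (ultra_fmap u UF) uFM)[l [_ ul]]; apply/cvg_ex; exists l.
Qed.

(** If every finite [s] fails, the sets [D s] of points missed by [s] generate a proper filter. At a
    cluster point [x], the neighbourhood [c x] would meet [D [:: x]], which is disjoint from it. *)
Lemma compact_open_nbhs_cover (T : topologicalType) (c : T -> set T) :
    compact [set: T] -> (forall x, open_nbhs x (c x)) ->
  exists s : seq T, forall y, exists2 x, x \in s & c x y.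
Proof.
move=> cT cx; apply: contrapT => /forallNP ns.
pose D (s : seq T) := [set y | forall x, x \in s -> ~ c x y].
have FF : ProperFilter (filter_from [set: seq T] D).
  apply: filter_from_proper.
    apply: filter_from_filter; first by exists [::].
    move=> s t _ _; exists (s ++ t) => // y sty; split=> x xs;
      by apply: sty; rewrite mem_cat xs ?orbT.
  move=> s _; apply: contrapT => /set0P/negP/negPn/eqP Ds; apply: (ns s) => y.
  apply: contrapT => yN; have : D s y by move=> x xs cxy; apply: yN; exists x.
  by rewrite Ds.
have [|x [_ xF]] := cT (filter_from [set: seq T] D) FF; first exact: filterT.
have [y [Dy]] : D [:: x] `&` c x !=set0.
  by apply: xF; [exists [:: x]|exact: open_nbhs_nbhs].
by apply: Dy; rewrite mem_head.
Qed.

(** * The Borel measure attached to an ultrafilter of measures *)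

Section limit_measure.
Context {R : realType} {X : ptopologicalType}.
Hypothesis Xcompact : compact [set: X].
Hypothesis Xnormal : normal_space X.
Local Notation B := (g_sigma_algebraType (@open X)).
Variable F : set_system (borel_prob R X).
Hypothesis UF : UltraFilter F.

Let FF : ProperFilter F. Proof. exact: ultra_proper. Qed.

Lemma open_measurable_borel (A : set B) : open (A : set X) -> measurable A.
Proof. exact: sub_sigma_algebra. Qed.

Lemma closed_measurable_borel (A : set B) : closed (A : set X) -> measurable A.
Proof.
move=> cA; rewrite -[A]setCK; apply: measurableC; apply: open_measurable_borel.
exact: closed_openC.
Qed.

(** Finite additivity survives this limit, but countable additivity may be lost, whence the
    regularisation that follows. *)
Definition limit_content (A : set B) : R :=
  lim ((fun mu : borel_prob R X => fine (mu A)) @ F).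
Local Notation nu := limit_content.

Lemma limit_content_cvg A : measurable A ->
  (fun mu : borel_prob R X => fine (mu A)) @ F --> nu A.
Proof.
move=> mA; apply: (@ultra_bounded_cvg _ _ _ 1) => // mu.
have mu1 : (mu A <= 1)%E by exact: probability_le1.
rewrite ger0_norm; last by apply: fine_ge0; exact: measure_ge0.
by rewrite -lee_fin fineK// fin_num_measure.
Qed.

Lemma limit_content_ge0 A : measurable A -> 0 <= nu A.
Proof.
move=> mA; apply: limr_ge; first by apply/cvg_ex; exists (nu A);
  exact: limit_content_cvg.
by apply: nearW => mu; apply: fine_ge0; exact: measure_ge0.
Qed.

Lemma limit_contentT : nu [set: B] = 1.
Proof.
rewrite /limit_content (_ : (fun _ => _) = (fun=> 1)) ?lim_cst//.
by apply/funext => mu; have /(congr1 fine) := probability_setT mu.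
Qed.

Lemma limit_contentU A C : measurable A -> measurable C -> [disjoint A & C] ->
  nu (A `|` C) = nu A + nu C.
Proof.
move=> mA mC sAC; apply/cvg_lim => //.
have -> : (fun mu : borel_prob R X => fine (mu (A `|` C))) =
    (fun mu : borel_prob R X => fine (mu A) + fine (mu C)).
  by apply/funext => mu; rewrite measureU ?fineD ?fin_num_measure//; exact/eqP.
by apply: cvgD; exact: limit_content_cvg.
Qed.

Lemma le_limit_content A C : measurable A -> measurable C -> A `<=` C ->
  nu A <= nu C.
Proof.
move=> mA mC sAC; rewrite -(setDUK sAC) limit_contentU//.
- by rewrite lerDl limit_content_ge0//; exact: measurableD.
- exact: measurableD.
- by apply/eqP; rewrite setDIK.
Qed.

Local Open Scope ereal_scope.

Definition inner_content (O : set X) : \bar R :=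
  ereal_sup [set (nu K)%:E | K in [set K : set X | closed K /\ K `<=` O]].
Local Notation lam := inner_content.

Lemma inner_content_ub O K : closed K -> K `<=` O -> (nu K)%:E <= lam O.
Proof. by move=> cK KO; apply: ereal_sup_ubound; exists K. Qed.

Lemma inner_content_ge0 O : 0 <= lam O.
Proof.
apply: (le_trans _ (@inner_content_ub O set0 closed0 _)) => //.
by rewrite lee_fin limit_content_ge0.
Qed.

Lemma inner_content_le1 O : lam O <= 1.
Proof.
apply: ge_ereal_sup => _ [K [cK _] <-]; rewrite lee_fin -limit_contentT.
by apply: le_limit_content => //; exact: closed_measurable_borel.
Qed.

Lemma limit_content0 : nu set0 = 0%R.
Proof.
have d0 : [disjoint (set0 : set B) & set0] by apply/eqP; rewrite set0I.
have := limit_contentU measurable0 measurable0 d0; rewrite setU0.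
by move=> /esym/eqP; rewrite -subr_eq0 addrK => /eqP.
Qed.

(** Induction on [n]: the part of [K] outside the first [n] open sets is closed and lies in [O n],
    so normality gives an open [C] around it with closure inside [O n]. The induction hypothesis
    covers [K] minus [C], and the rest lies in the closed set [K] intersected with the closure of
    [C]. *)
Lemma limit_content_finite_cover n (O : nat -> set X) (K : set X) :
    (forall i, open (O i)) -> closed K ->
    K `<=` \big[setU/set0]_(i < n) O i ->
  (nu K)%:E <= \sum_(i < n) lam (O i).
Proof.
move=> oO; elim: n K => [|n ih] K cK.
  by rewrite !big_ord0 subset0 => ->; rewrite limit_content0.
rewrite !big_ord_recr/= => KO.
have oU : open (\big[setU/set0]_(i < n) O i) by rewrite -bigcup_mkord;
  exact: bigcup_open.
have cL : closed (K `\` \big[setU/set0]_(i < n) O i).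
  by rewrite setDE; apply: closedI => //; exact: open_closedC.
have [C [oC LC CO]] : exists C : set X, [/\ open C,
    K `\` \big[setU/set0]_(i < n) O i `<=` C & closure C `<=` O n].
  have LOn : set_nbhs (K `\` \big[setU/set0]_(i < n) O i) (O n).
    move=> x [Kx nx]; apply: open_nbhs_nbhs; split => //.
    by have [|//] := KO x Kx.
  have [D /set_nbhsP[C [oC LC CD]] DO] := Xnormal cL LOn.
  exists C; split=> //.
  by apply: subset_trans DO; exact: closure_subset.
have cKC : closed (K `&` closure C) by apply: closedI => //;
  exact: closed_closure.
have cKD : closed (K `\` C) by rewrite setDE; apply: closedI => //;
  exact: open_closedC.
have KE : K = (K `\` C) `|` (K `&` C) by rewrite setUC setUIDK.
apply: (@le_trans _ _ ((nu (K `\` C))%:E + (nu (K `&` closure C))%:E)).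
  rewrite -EFinD lee_fin {1}KE limit_contentU.
  - rewrite lerD2l; apply: le_limit_content.
    + apply: measurableI; first exact: closed_measurable_borel.
      exact: open_measurable_borel.
    + exact: closed_measurable_borel.
    + by apply: setIS; exact: subset_closure.
  - exact: closed_measurable_borel.
  - apply: measurableI; first exact: closed_measurable_borel.
    exact: open_measurable_borel.
  - by apply/eqP; rewrite -subset0 => x [[_ ?] []].
apply: leeD; last by apply: inner_content_ub => // x [_ /CO].
apply: ih => // x [Kx nCx]; apply: contrapT => nx.
by apply: nCx; apply: LC.
Qed.

(** A closed subset of the union is compact, hence lies in finitely many of the [O i]. *)
Lemma inner_content_bigcup (O : nat -> set X) : (forall i, open (O i)) ->
  lam (\bigcup_i O i) <= \sum_(i <oo) lam (O i).
Proof.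
move=> oO; apply: ge_ereal_sup => _ [K [cK KO] <-].
have [n Kn] : exists n, K `<=` \big[setU/set0]_(i < n) O i.
  have cptK : compact K by apply: (subclosed_compact cK Xcompact).
  move: cptK; rewrite compact_cover => /(_ nat setT O (fun i _ => oO i) KO).
  move=> [D _ KD]; exists (\max_(i <- finmap.enum_fset D) i).+1 =>
    x /KD[i /= iD Oix].
  rewrite -bigcup_mkord; exists i => //=.
  by rewrite ltnS; exact: (@leq_bigmax_seq _ _ xpredT id).
apply: (le_trans (limit_content_finite_cover oO cK Kn)).
rewrite -(big_mkord xpredT (fun i => lam (O i))).
by apply: nneseries_lim_ge => i _ _; exact: inner_content_ge0.
Qed.

Definition limit_outer (E : set X) : \bar R :=
  ereal_inf [set lam O | O in [set O : set X | open O /\ E `<=` O]].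
Local Notation mu := limit_outer.

Lemma limit_outer_lb E O : open O -> E `<=` O -> mu E <= lam O.
Proof. by move=> oO EO; apply: ereal_inf_lbound; exists O. Qed.

Lemma limit_outer_ge0 E : 0 <= mu E.
Proof.
by apply: le_ereal_inf_tmp => _ [W _ <-]; exact: inner_content_ge0.
Qed.

Lemma limit_outer_fin_num E : mu E \is a fin_num.
Proof.
rewrite ge0_fin_numE ?limit_outer_ge0//.
apply: (le_lt_trans (@limit_outer_lb E setT openT _)) => //.
by apply: (le_lt_trans (inner_content_le1 _)); rewrite ltry.
Qed.

Let limit_outer0 : mu set0 = 0.
Proof.
apply/eqP; rewrite eq_le limit_outer_ge0 andbT.
apply: (le_trans (@limit_outer_lb set0 set0 open0 _)) => //.
apply: ge_ereal_sup => _ [K [_ +] <-]; rewrite subset0 => ->.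
by rewrite limit_content0.
Qed.

Let le_limit_outer : {homo mu : A C / A `<=` C >-> A <= C}.
Proof.
move=> A C sAC; apply: le_ereal_inf_tmp => _ [W [oW CW] <-].
by apply: limit_outer_lb => //; exact: subset_trans CW.
Qed.

Let limit_outer_sigma_subadditive : sigma_subadditive mu.
Proof.
move=> E; apply/lee_addgt0Pr => e e0.
apply: (le_trans _ (epsilon_trick xpredT (fun i =>
  limit_outer_ge0 (E i)) (ltW e0))).
have /choice[U EU] : forall i, exists O, [/\ open O, E i `<=` O &
    lam O <= mu (E i) + (e / (2 ^ i.+1)%:R)%:E].
  move=> i; have ei : (0 < e / (2 ^ i.+1)%:R)%R.
    by rewrite divr_gt0// ltr0n expn_gt0.
  have [_ [W [oW EW] <-] /ltW ?] :=
    lb_ereal_inf_adherent ei (limit_outer_fin_num (E i)).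
  by exists W.
apply: (@le_trans _ _ (lam (\bigcup_i U i))).
  apply: limit_outer_lb; first by apply: bigcup_open => i _; have [] := EU i.
  by apply: subset_bigcup => i _; have [] := EU i.
apply: (le_trans (inner_content_bigcup _)); first by move=> i; have [] := EU i.
apply: lee_nneseries => [i * |i *]; first exact: inner_content_ge0.
by have [] := EU i.
Qed.

HB.instance Definition _ := isOuterMeasure.Build R X mu
  limit_outer0 limit_outer_ge0 le_limit_outer limit_outer_sigma_subadditive.

(* Nearly exhaust W `&` O
  by a closed K, then W `\` K, which contains W `\` O, by
   a closed L: these are disjoint closed subsets of W. *)
Lemma open_caratheodory (O : set X) : open O -> mu.-caratheodory O.
Proof.
move=> oO; apply: le_caratheodory_measurable => E.
apply: le_ereal_inf_tmp => _ [W [oW EW] <-].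
apply: (@le_trans _ _ (lam (W `&` O) + mu (E `&` ~` O))).
  apply: leeD => //; apply: limit_outer_lb; first exact: openI.
  exact: setSI.
rewrite -leeBrDr ?limit_outer_fin_num//.
apply: ge_ereal_sup => _ [K [cK KWO] <-].
rewrite leeBrDr ?limit_outer_fin_num// addeC -leeBrDr//.
have oWK : open (W `\` K) by rewrite setDE; apply: openI => //;
  exact: closed_openC.
apply: (@le_trans _ _ (lam (W `\` K))).
  apply: limit_outer_lb => // x [Ex nOx]; split; first exact: EW.
  by move=> /KWO[].
apply: ge_ereal_sup => _ [L [cL LWK] <-].
rewrite leeBrDr// -EFinD -limit_contentU.
- apply: inner_content_ub; first exact: closedU.
  by move=> x [/LWK[]|/KWO[]].
- exact: closed_measurable_borel.
- exact: closed_measurable_borel.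
- by apply/eqP; rewrite -subset0 => x [/LWK[]].
Qed.

(** The Caratheodory measurable sets form a sigma-algebra, and it contains the open sets. *)
Lemma borel_caratheodory (A : set B) : measurable A -> mu.-caratheodory A.
Proof.
move=> mA; have : (@measurable _ (caratheodory_type mu)) A; last by [].
move: A mA; apply: smallest_sub; first exact: sigma_algebra_measurable.
by move=> O oO; exact: open_caratheodory.
Qed.

Let limit_outer_sigma_additive : semi_sigma_additive (mu : set B -> \bar R).
Proof.
move=> A mA tA mUA.
apply: (@caratheodory_measure_sigma_additive R X mu) => //.
  by move=> i; apply: borel_caratheodory.
exact: borel_caratheodory.
Qed.

(** [K] itself competes in the supremum defining [inner_content] of any open set around [K]. *)
Lemma limit_outer_closed (K : set X) : closed K -> (nu K)%:E <= mu K.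
Proof.
move=> cK; apply: le_ereal_inf_tmp => _ [W [oW KW] <-].
exact: inner_content_ub.
Qed.

Lemma limit_outerT : mu setT = 1.
Proof.
apply/eqP; rewrite eq_le; apply/andP; split.
  by apply: (le_trans (@limit_outer_lb setT setT openT _)) => //;
    exact: inner_content_le1.
by rewrite -limit_contentT; apply: limit_outer_closed; exact: closedT.
Qed.

Lemma limit_measure_exists : exists m : borel_prob R X,
  forall K, closed K -> (nu K <= fine (m K))%R.
Proof.
have [m mE] := borel_prob_exists limit_outer0 limit_outer_ge0
  limit_outer_sigma_additive limit_outerT.
exists m => K cK; rewrite mE; last exact: closed_measurable_borel.
by rewrite -lee_fin fineK ?limit_outer_fin_num// limit_outer_closed.
Qed.

End limit_measure.

(** A discrete layer cake formula: the integer part of [y] counts the levels 1, ..., n that [y]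
    reaches. *)
Lemma sum_ltn_truncn (R : realType) (y : R) n : 0 <= y <= n%:R ->
  \sum_(j < n) ((j.+1%:R <= y)%R : nat)%:R = (Num.truncn y)%:R :> R.
Proof.
move=> /andP[y0 yn].
have tn : (Num.truncn y <= n)%N.
  by have := le_truncn yn; rewrite natrK.
under eq_bigr do rewrite -truncn_gt_nat.
rewrite -natr_sum; congr _%:R; move: tn; set t := Num.truncn y.
elim: n {yn} => [|n ih]; first by rewrite leqn0 big_ord0 => /eqP ->.
rewrite leq_eqVlt big_ord_recr/= => /predU1P[->|].
  rewrite ltnSn (eq_bigr (fun=> 1%N)) => [|i _];
    first by rewrite sum_nat_const card_ord muln1 addn1.
  by rewrite ltnS ltnW ?ltn_ord.
by rewrite ltnS => tn; rewrite ih// ltnNge tn addn0.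
Qed.

(** * Integrals through level sets, and compactness of M(X) *)

Section weak_star_compactness.
Context {R : realType} {X : ptopologicalType}.
Hypothesis Xcompact : compact [set: X].
Local Notation B := (g_sigma_algebraType (@open X)).
Implicit Types (mu : borel_prob R X) (f g : X -> R).

(** These sets are closed for continuous [g], so the inequality between [nu] and [m] applies to
    them. Levels start at 1 since [g] will be non-negative. *)
Definition upper_level g (j : nat) : set B := [set x | j.+1%:R <= g x].

Lemma closed_upper_level g j : continuous g -> closed (upper_level g j : set X).
Proof.
by move=> /continuous_closedP cg; apply: (cg [set y | j.+1%:R <= y]);
  exact: closed_ge.
Qed.

Lemma measurable_upper_level g j : continuous g -> measurable (upper_level g j).
Proof.
by move=> cg; apply: closed_measurable_borel; exact: closed_upper_level.
Qed.

(** The sum [h] of the indicators of the level sets is the integer part of [g], so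
    [h <= g <= h + 1]. *)
Lemma mean_upper_level g n mu : continuous g -> (forall x, 0 <= g x <= n%:R) ->
  \sum_(j < n) fine (mu (upper_level g j)) <= mean g mu <=
  \sum_(j < n) fine (mu (upper_level g j)) + 1.
Proof.
move=> cg gn; pose h (x : B) : R := \sum_(j < n) \1_(upper_level g j) x.
have hE x : h x = (Num.truncn (g x))%:R.
  rewrite -(sum_ltn_truncn (gn x)); apply: eq_bigr => j _.
  by rewrite indicE; congr (nat_of_bool _)%:R; apply/idP/idP => [/set_mem|?];
    last exact/mem_set.
have hint : mu.-integrable setT (EFin \o h).
  rewrite (_ : _ \o _ = fun x => (\sum_(j < n) (\1_(upper_level g j) x)%:E)%E).
    apply: integrable_sum => // j _; apply: integrable_indic.
    exact: measurable_upper_level.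
  by apply/funext => x; rewrite /h /= sumEFin.
have -> : \sum_(j < n) fine (mu (upper_level g j)) = \int[mu]_x h x.
  apply: EFin_inj; rewrite /Rintegral fineK; last exact: integrable_fin_num.
  under eq_integral do rewrite /h -sumEFin.
  rewrite ge0_integral_sum//; last first.
    by move=> j; apply/measurable_EFinP; apply: measurable_indic;
      exact: measurable_upper_level.
  rewrite -sumEFin; apply: eq_bigr => j _.
  rewrite integral_indic//; last exact: measurable_upper_level.
  by rewrite setIT fineK// fin_num_measure//; exact: measurable_upper_level.
have gint := integrable_continuous Xcompact mu cg.
apply/andP; split.
  rewrite /mean; apply: le_Rintegral => // x _; rewrite hE.
  by have /andP[g0 _] := gn x; have /andP[] := truncn_itv g0.
rewrite -[in leRHS](mean_cst mu 1) /mean -RintegralD//; last first.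
  by apply: (integrable_continuous Xcompact mu (f := fun=> 1)) => x;
    exact: cst_continuous.
apply: le_Rintegral => //.
  rewrite (_ : _ \o _ = (EFin \o (h : B -> R)) \+ (EFin \o (fun=> 1)))//.
  apply: integrableD => //.
  by apply: (integrable_continuous Xcompact mu (f := fun=> 1)) => x;
    exact: cst_continuous.
move=> x _; rewrite hE.
by have /andP[g0 _] := gn x; have /andP[_ /ltW] := truncn_itv g0;
  rewrite -natr1.
Qed.


Section limit.
Variables (F : set_system (borel_prob R X)) (m : borel_prob R X).
Hypothesis UF : UltraFilter F.
Hypothesis Fm : forall K : set X, closed K -> limit_content F K <= fine (m K).

Let FF : ProperFilter F. Proof. exact: ultra_proper. Qed.

Lemma is_cvg_mean_ultra f : continuous f -> cvg (mean f @ F).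
Proof.
move=> cf; have [M fM] := continuous_bounded Xcompact cf.
by apply: (@ultra_bounded_cvg _ _ _ M) => // mu; exact: mean_bound.
Qed.

(** The upper bound of [mean_upper_level] passes to the limit along [F]; [Fm] compares the measures
    of each level set, and the lower bound for [m] concludes. *)
Lemma lim_mean_le_approx g n : continuous g -> (forall x, 0 <= g x <= n%:R) ->
  lim (mean g @ F) <= mean g m + 1.
Proof.
move=> cg gn.
have cvgS : (fun mu : borel_prob R X =>
  \sum_(j < n) fine (mu (upper_level g j)) + 1)
    @ F --> \sum_(j < n) limit_content F (upper_level g j) + 1.
  apply: cvgD; last exact: cvg_cst.
  elim: n {gn} => [|n ih].
    by rewrite big_ord0; under eq_fun do rewrite big_ord0; exact: cvg_cst.
  rewrite big_ord_recr; under eq_fun do rewrite big_ord_recr.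
  by apply: cvgD => //; apply: limit_content_cvg; exact: measurable_upper_level.
apply: (@le_trans _ _ (\sum_(j < n) limit_content F (upper_level g j) + 1)).
  apply: (ler_cvg_to (is_cvg_mean_ultra cg) cvgS).
  by apply: nearW => mu; have /andP[_] := mean_upper_level mu cg gn.
rewrite lerD2r; have /andP[+ _] := mean_upper_level m cg gn.
apply: le_trans; apply: ler_sum => j _; apply: Fm; exact: closed_upper_level.
Qed.

(* The previous bound has error 1 at every scale; apply it to N * (f + M). *)
Lemma lim_mean_le f : continuous f -> lim (mean f @ F) <= mean f m.
Proof.
move=> cf; have [M fM] := continuous_bounded Xcompact cf.
have cM : continuous (fun _ : X => M) by move=> x; exact: cst_continuous.
have cfM : continuous (fun x => f x + M).
  by move=> x; apply: continuousD; [exact: cf|exact: cM].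
have approx (N : nat) : N%:R * (lim (mean f @ F) - mean f m) <= 1.
  pose g x := N%:R * (f x + M).
  have cg : continuous g.
    by move=> x; apply: cvgM; [exact: cvg_cst|exact: cfM].
  have gE mu : mean g mu = N%:R * (mean f mu + M).
    by rewrite /g meanZ// meanD// mean_cst.
  pose n := Num.truncn (N%:R * (M + M)).
  have /lim_mean_le_approx : forall x, 0 <= g x <= n.+1%:R.
    move=> x; have := fM x; rewrite ler_norml => /andP[Mf fM'].
    rewrite mulr_ge0//=; last by rewrite -lerBlDr sub0r.
    by apply: ltW; apply: le_lt_trans (truncnS_gt _);
      rewrite ler_wpM2l// lerD2r.
  move=> /(_ cg); rewrite gE.
  have -> : lim (mean g @ F) = N%:R * (lim (mean f @ F) + M).
    rewrite (_ : mean g = fun mu => N%:R * (mean f mu + M)); last exact/funext.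
    apply/cvg_lim => //; apply: cvgM; first exact: cvg_cst.
    by apply: cvgD; [exact: is_cvg_mean_ultra|exact: cvg_cst].
  lra.
rewrite -subr_le0 leNgt; apply/negP => d0.
(* An integer larger than the inverse of a positive gap contradicts [approx]. *)
have := approx (Num.truncn (lim (mean f @ F) - mean f m)^-1).+1.
by rewrite leNgt -ltr_pdivrMr// mul1r truncnS_gt.
Qed.

Lemma limit_measure_cvg : F --> m.
Proof.
apply/cvg_sup => -[f cf] /= A.
rewrite (@nbhsE (initial_topology (mean f))) => -[_ [[C oC <-] Cm]] CA.
suff : F (mean f @^-1` C) by apply: filterS.
(* Equality comes from applying the one-sided inequality to [f] and to its opposite. *)
have e : lim (mean f @ F) = mean f m.
  apply/le_anti; rewrite lim_mean_le//= -lerN2.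
  have cNf : continuous (fun x => - f x) by move=> x; exact/continuousN/cf.
  have NE mu : mean (fun x => - f x) mu = - mean f mu.
    rewrite (_ : (fun x => - f x) = (fun x => -1 * f x)) ?meanZ ?mulN1r//.
    by apply/funext => x; rewrite mulN1r.
  rewrite -NE -limN; last exact: is_cvg_mean_ultra.
  have -> : - mean f = mean (fun x => - f x) by apply/funext => mu; rewrite NE.
  exact: lim_mean_le.
have : mean f @ F --> mean f m by rewrite -e; exact: is_cvg_mean_ultra.
by apply; exact: open_nbhs_nbhs.
Qed.

End limit.

Lemma borel_prob_compact : hausdorff_space X ->
  compact [set: borel_prob R X].
Proof.
move=> hX; rewrite compact_ultra => F UF _.
have [m Fm] := limit_measure_exists Xcompact (compact_normal hX Xcompact) UF.
by exists m; split => //; exact: limit_measure_cvg.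
Qed.

End weak_star_compactness.

(** * Test functions and separation *)

Section lebesgue_number.
Context {R : realType} {Z : topologicalType}.
Hypothesis Zcompact : compact [set: Z].
Implicit Types (s : seq (Z -> R)).

(** Closeness measured by finitely many test functions. It serves both on X, with continuous
    functions, and on M(X), with their integrals. *)
Definition fclose s (e : R) (z w : Z) : Prop :=
  forall f, f \in s -> `|f z - f w| < e.

Lemma fclose_sym s e z w : fclose s e z w -> fclose s e w z.
Proof. by move=> h f fs; rewrite distrC; exact: h. Qed.

Lemma open_nbhs_fclose s e z : (forall f, f \in s -> continuous f) -> 0 < e ->
  open_nbhs z [set w | fclose s e z w].
Proof.
move=> cs e0; split; last by move=> f _; rewrite subrr normr0.
elim: s cs => [_|f s ih cs].
  rewrite (_ : mkset _ = setT); first exact: openT.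
  by rewrite -subTset => w _ f.
rewrite (_ : mkset _ = (fun w => `|f z - f w|) @^-1` [set r | r < e] `&`
    [set w | fclose s e z w]).
  apply: openI; last by apply: ih => g gs; apply: cs; rewrite in_cons gs orbT.
  apply: open_comp; last exact: open_lt.
  move=> w _; apply: cvg_norm; apply: cvgB; first exact: cvg_cst.
  by apply: cs; rewrite mem_head.
apply/seteqP; split => w /=.
  by move=> h; split=> [|g gs]; apply: h; rewrite in_cons ?eqxx ?gs ?orbT.
by move=> [fw sw] g; rewrite in_cons => /predU1P[->//|]; exact: sw.
Qed.

Lemma fine_cover s e : (forall f, f \in s -> continuous f) -> 0 < e ->
  exists2 U, finite_open_cover U & forall A z w, U A -> A z -> A w ->
    fclose s e z w.
Proof.
move=> cs e0; have e20 : 0 < e / 2 by rewrite divr_gt0.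
have [t tZ] := compact_open_nbhs_cover Zcompact
  (fun z => open_nbhs_fclose z cs e20).
exists [set [set w | fclose s (e / 2) z w] | z in [set` t]].
  split.
  - by apply: finite_image; exact: finite_seq.
  - by move=> _ [z _ <-]; have [] := open_nbhs_fclose z cs e20.
  - rewrite -subTset => w _; have [z zt zw] := tZ w.
    by exists [set w | fclose s (e / 2) z w] => //; exists z.
move=> _ z w [y _ <-] yz yw f fs.
have := yz _ fs; have := yw _ fs; rewrite distrC => h1 h2.
rewrite distrC (le_lt_trans (ler_distD (f y) _ _))//.
by rewrite [ltRHS](splitr e) ltrD.
Qed.

(** A Lebesgue number lemma. Finitely many balls of half radius cover the space; if [y] lies in the
    half ball around [z], then points sufficiently close to [y] lie in the full ball around [z],
    hence in [A z]. The test functions of all the centres are collected in one list. *)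
Lemma lebesgue_fclose (P : set (Z -> R)) (U : set (set Z)) :
    (forall f, P f -> continuous f) ->
    (forall z A, nbhs z A -> exists s e, [/\ 0 < e, forall f, f \in s -> P f &
       [set w | fclose s e z w] `<=` A]) ->
    finite_open_cover U ->
  exists s e, [/\ 0 < e, forall f, f \in s -> P f &
    forall z, exists2 A, U A & [set w | fclose s e z w] `<=` A].
Proof.
move=> cP baseP [_ oU UZ].
have /choice[A UA] : forall z, exists A, U A /\ A z.
  by move=> z; have : [set: Z] z by []; rewrite -UZ => -[A]; exists A.
have /choice[s /choice[e se]] : forall z, exists s e, [/\ 0 < e,
    forall f, f \in s -> P f & [set w | fclose s e z w] `<=` A z].
  by move=> z; apply: baseP; apply: open_nbhs_nbhs; split;
    [apply: oU; exact: (UA z).1|exact: (UA z).2].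
have e20 z : 0 < e z / 2 by rewrite divr_gt0//; have [] := se z.
have cs z f : f \in s z -> continuous f.
  by move=> fs; apply: cP; have [_ sP _] := se z; exact: sP.
have [t tZ] := compact_open_nbhs_cover Zcompact
  (fun z => open_nbhs_fclose z (cs z) (e20 z)).
have [e' e'0 e't] : exists2 e' : R, 0 < e' & forall z, z \in t -> e' <= e z / 2.
  elim: t {tZ} => [|z t [e' e'0 ih]]; first by exists 1.
  exists (Num.min e' (e z / 2)); first by rewrite lt_min e'0 e20.
  move=> y; rewrite in_cons ge_min => /predU1P[->|/ih ->//].
  by rewrite lexx orbT.
exists (flatten [seq s z | z <- t]), e'; split=> //.
  by move=> f /flattenP[_ /mapP[z _ ->]]; have [_ + _] := se z; exact.
move=> y; have [z zt zy] := tZ y; exists (A z); first exact: (UA z).1.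
move=> w yw; have [_ _] := se z; apply => f fs.
rewrite (le_lt_trans (ler_distD (f y) _ _))//.
rewrite [ltRHS]splitr ltrD//; first exact: zy.
apply: (@lt_le_trans _ _ e'); last exact: e't.
by apply: yw; apply/flattenP; exists (s z) => //; apply/mapP; exists z.
Qed.

End lebesgue_number.

(** Greedy choice: each set of points close to a chosen one lies in a member of [U], so fewer than
    [cover_number U] of these sets cannot cover the space. *)
Lemma separated_family (Z : topologicalType) (U : set (set Z))
    (close : Z -> Z -> Prop) :
    (forall z w, close z w -> close w z) ->
    (forall z, exists2 A, U A & [set w | close z w] `<=` A) -> Z ->
  exists z : 'I_(cover_number U) -> Z, forall i j, i != j ->
    ~ close (z i) (z j).
Proof.
move=> sym cU z0; set N := cover_number U.
suff h k : (k <= N)%N -> exists z : nat -> Z,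
    forall i j, (i < j)%N -> (j < k)%N -> ~ close (z i) (z j).
  have [z zN] := h _ (leqnn N); exists (z \o val) => i j; rewrite neq_ltn.
  by move=> /orP[ij|ij]; [|move=> /sym]; exact: zN ij (ltn_ord _).
elim: k => [|k ih] kN; first by exists (fun=> z0).
have [z zk] := ih (ltnW kN).
have [w zw] : exists w, forall i : 'I_k, ~ close (z i) w.
  apply: contrapT => /forallNP nw.
  suff : (N <= #|'I_k|)%N by rewrite card_ord leqNgt kN.
  apply: (@cover_number_le _ U 'I_k (fun i => [set w | close (z i) w])).
    by move=> i; exact: cU.
  by move=> w; have /existsNP[i /contrapT ?] := nw w; exists i.
exists (fun i => if i == k then w else z i) => i j ij.
rewrite ltnS leq_eqVlt => /predU1P[jk|jk].
  by rewrite jk eqxx ltn_eqF -?jk//; rewrite jk in ij; exact: (zw (Ordinal ij)).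
by rewrite !ltn_eqF//; [exact: zk|exact: (ltn_trans ij)].
Qed.

(** * Test functions on a metric space *)

Section metric.
Context {R : realType} {X : topologicalType}.
Variable d : X -> X -> R.
Hypothesis d_ge0 : forall x y, 0 <= d x y.
Hypothesis d_eq0 : forall x y, d x y = 0 <-> x = y.
Hypothesis d_sym : forall x y, d x y = d y x.
Hypothesis d_tri : forall x y z, d x z <= d x y + d y z.
Hypothesis d_nbhs : forall (x : X) (A : set X),
  nbhs x A <-> exists2 e : R, 0 < e & [set y | d x y < e] `<=` A.

Lemma dist_continuous x : continuous (d x).
Proof.
move=> y; apply/cvgrPdist_lt => e e0; apply/d_nbhs; exists e => // z /= yz.
rewrite ltr_norml; apply/andP; split.
  by rewrite ltrBrDr; have := d_tri x y z; lra.
by have := d_tri x z y; rewrite (d_sym z y); lra.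
Qed.

Lemma dist_hausdorff : hausdorff_space X.
Proof.
move=> x y xy; apply: contrapT => nxy.
have dxy : 0 < d x y.
  by rewrite lt_neqAle d_ge0 andbT eq_sym; apply/eqP => /d_eq0.
have d2 : 0 < d x y / 2 by rewrite divr_gt0.
have ball z : nbhs z [set w | d z w < d x y / 2] by apply/d_nbhs;
  exists (d x y / 2).
have [z [/= xz yz]] := xy _ _ (ball x) (ball y).
by have := d_tri x z y; rewrite (d_sym z y); lra.
Qed.

(** The single test function [d z] cuts out the balls around [z]. *)
Lemma dist_fclose_base z A : nbhs z A -> exists s e, [/\ 0 < e,
  forall f, f \in s -> [set f : X -> R | continuous f] f &
  [set w | fclose s e z w] `<=` A].
Proof.
move=> /d_nbhs[e e0 eA]; exists [:: d z], e; split=> //.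
  by move=> f; rewrite inE => /eqP ->; exact: dist_continuous.
move=> w /(_ (d z)); rewrite mem_head => /(_ erefl) zw; apply: eA => /=.
have zz : d z z = 0 by apply/d_eq0.
by move: zw; rewrite zz sub0r normrN ger0_norm.
Qed.

End metric.

Section weak_star_base.
Context {R : realType} {X : ptopologicalType}.

(** The sets satisfying the conclusion form a filter [G]. In a supremum topology, [G --> mu] can be
    checked for one test function at a time. *)
Lemma weak_star_fclose_base (mu : borel_prob R X) A : nbhs mu A ->
  exists s e, [/\ 0 < e,
    forall f, f \in s -> [set mean g | g in [set g : X -> R | continuous g]] f &
    [set nu | fclose s e mu nu] `<=` A].
Proof.
pose G : set_system (borel_prob R X) := [set A | exists s e, [/\ 0 < e,
    forall f, f \in s -> [set mean g | g in [set g : X -> R | continuous g]] f &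
    [set nu | fclose s e mu nu] `<=` A]].
have GF : Filter G.
  split.
  - by exists [::], 1.
  - move=> C D [s [e [e0 sP sC]]] [t [e' [e'0 tP tD]]].
    exists (s ++ t), (Num.min e e'); split.
    + by rewrite lt_min e0 e'0.
    + by move=> f; rewrite mem_cat => /orP[/sP|/tP].
    + move=> nu h; split; [apply: sC|apply: tD] => f fs;
      by have := h f; rewrite mem_cat fs ?orbT lt_min => /(_ erefl)/andP[].
  - move=> C D CD [s [e [e0 sP sC]]]; exists s, e; split=> //.
    exact: subset_trans CD.
suff : G --> mu by exact.
apply/cvg_sup => -[f cf] /= C.
rewrite (@nbhsE (initial_topology (mean f))) => -[_ [[D oD <-] Dmu]] DC.
have /nbhs_ballP[e /= e0 eD] : nbhs (mean f mu) D by exact: open_nbhs_nbhs.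
exists [:: mean f], e; split=> //.
  by move=> g; rewrite inE => /eqP ->; exists f.
move=> nu h; apply: DC; apply: eD => /=.
by rewrite /ball/=; apply: h; rewrite mem_head.
Qed.

End weak_star_base.

(** * From X to M(X) *)

Section lower_bound.
Context {R : realType} {X : ptopologicalType}.
Hypothesis Xcompact : compact [set: X].
Local Notation B := (g_sigma_algebraType (@open X)).

Lemma borel_prob_inhabited : inhabited (borel_prob R X).
Proof.
pose m : {measure set B -> \bar R} := dirac (point : B).
have [nu _] := borel_prob_exists (measure0 m) (measure_ge0 m)
  (@measure_semi_sigma_additive _ _ _ m) (diracT _ _).
exact: inhabits nu.
Qed.

(* The new weight t is so small that the term t * delta_x cannot undo the
   separation by e' obtained at the previous step. *)
Lemma separated_mixtures (M e : R) (k : nat) : 0 < M -> 0 < e ->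
  exists2 e' : R, 0 < e' & forall (S : set (X -> R)) (J : finType) (x : J -> X),
    (forall f, S f -> continuous f /\ forall y, `|f y| <= M) ->
    (forall i j, i != j -> exists2 f, S f & e <= `|f (x i) - f (x j)|) ->
  exists (K : finType) (mu : K -> borel_prob R X), #|K| = (#|J| ^ k)%N /\
    forall i j, i != j -> exists2 f, S f & e' <= `|mean f (mu i) - mean f (mu
      j)|.
Proof.
move=> M0 e0; elim: k => [|k [e' e'0 ih]].
  exists 1 => // S J x _ _; have [mu] := borel_prob_inhabited.
  by exists unit, (fun=> mu); split; [rewrite card_unit|case=> -[]].
(* This [t] solves [(1 - t) * e' - t * (2 * M) = e' / 2]. *)
pose t := e' / (2 * (e' + 2 * M)).
have t0 : 0 < t by rewrite divr_gt0// mulr_gt0// addr_gt0// mulr_gt0.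
have tE : t * (e' + 2 * M) = e' / 2.
  rewrite /t; field; lra.
clearbody t; have t1 : t <= 1 by nra.
have t01 : 0 <= t <= 1 by rewrite ltW.
(* [e' / 2] serves the pairs with different old mixtures, [t * e] those with the same old mixture
   and different new Dirac masses. *)
exists (Num.min (e' / 2) (t * e)); first by rewrite lt_min; apply/andP; split;
  apply: mulr_gt0; rewrite ?invr_gt0.
move=> S J x SM xS; have [K [mu [cK muS]]] := ih S J x SM xS.
have /choice[nu nuE] : forall p : K * J, exists nu : borel_prob R X,
    forall f, continuous f ->
      mean f nu = (1 - t) * mean f (mu p.1) + t * f (x p.2).
  by move=> p; exact: mean_dirac_mixture.
exists (K * J)%type, nu; split; first by rewrite card_prod cK expnSr.
move=> [i1 j1] [i2 j2]; have [<- ne|ne _] := eqVneq i1 i2.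
  have j12 : j1 != j2 by apply: contra ne => /eqP ->.
  have [f Sf ef] := xS _ _ j12; exists f => //; have [cf _] := SM f Sf.
  rewrite ge_min !nuE//=; apply/orP; right.
  rewrite opprD addrACA subrr add0r -mulrBr normrM gtr0_norm//.
  by rewrite ler_pM2l.
have [f Sf ef] := muS _ _ ne; exists f => //; have [cf fM] := SM f Sf.
rewrite ge_min !nuE//=; apply/orP; left.
set a := mean f (mu i1) in ef *; set b := mean f (mu i2) in ef *.
have fxx : `|f (x j1) - f (x j2)| <= M + M.
  by rewrite (le_trans (ler_normB _ _))// lerD.
have -> : (1 - t) * a + t * f (x j1) - ((1 - t) * b + t * f (x j2)) =
  (1 - t) * (a - b) + t * (f (x j1) - f (x j2)) by ring.
apply: le_trans (lerB_normD _ _).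
rewrite !normrM (gtr0_norm t0) ger0_norm; last by lra.
have : (1 - t) * e' <= (1 - t) * `|a - b| by rewrite ler_wpM2l//; lra.
have : t * `|f (x j1) - f (x j2)| <= t * (M + M) by rewrite ler_wpM2l// ltW.
lra.
Qed.

Lemma common_bound (s : seq (X -> R)) : (forall f, f \in s -> continuous f) ->
  exists2 M : R, 0 < M & forall f, f \in s -> forall x, `|f x| <= M.
Proof.
elim: s => [|f s ih] cs; first by exists 1.
have [M M0 sM] := ih (fun g gs => cs g (@mem_behead _ (f :: s) g gs)).
have [N fN] := continuous_bounded Xcompact (cs f (mem_head f s)).
exists (Num.max M N); first by rewrite lt_max M0.
move=> g; rewrite in_cons => /predU1P[->|/sM gM] x; rewrite le_max.
  by rewrite fN orbT.
by rewrite gM.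
Qed.

Context {G : groupType} (a : action G X).

Lemma iterated_join_fclose (Z : topologicalType) (b : action G Z) (U : set (set
  Z))
    s (e : R) S n A z w :
    (forall A z w, U A -> A z -> A w -> fclose s e z w) ->
    iterated_join b U S n A -> A z -> A w ->
  forall i, (0 < i <= n)%N -> fclose s e (b (S i) z) (b (S i) w).
Proof.
move=> Us /iterated_joinP[C UC ->] zC wC i i_n.
by apply: (Us (C i)); [exact: UC|exact: zC|exact: wC].
Qed.

Lemma iterated_join_lebesgue (Z : topologicalType) (b : action G Z) (U : set
  (set Z))
    s (e : R) S n z :
    (forall z, exists2 A, U A & [set w | fclose s e z w] `<=` A) ->
  exists2 A, iterated_join b U S n A &
    [set w | forall i, (0 < i <= n)%N ->
      fclose s e (b (S i) z) (b (S i) w)] `<=` A.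
Proof.
move=> Us.
have /choice[C UC] : forall i, exists C, U C /\ [set w | fclose s e (b (S i) z)
  w] `<=` C.
  by move=> i; have [C] := Us (b (S i) z); exists C.
exists [set w | forall i, (0 < i <= n)%N -> C i (b (S i) w)].
  by apply/iterated_joinP; exists C => // i _; exact: (UC i).1.
by move=> w h i i_n; apply: (UC i).2; exact: h.
Qed.

(** As many points as the covering number are pairwise separated by test functions composed with
    some [a (S i)]. All these compositions share the bound [M], so the separation [e'] of the
    mixtures, and with it [V], is fixed before [S] and [n]. A member of the join of [V] then
    contains at most one mixture. *)
Lemma cover_number_pushforward_ge (U : set (set X)) k : metrizable R X ->
    compact [set: borel_prob R X] -> finite_open_cover U ->
  exists2 V, finite_open_cover V & forall S n,
    (cover_number (iterated_join a U S n) ^ k <=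
     cover_number (iterated_join (pushforward_action R a) V S n))%N.
Proof.
move=> [d [d0 dE dC dT dN]] Mcompact Ucover.
have [s [e [e0 cs Us]]] := lebesgue_fclose Xcompact
  (P := [set f : X -> R | continuous f]) (fun f cf => cf)
  (fun z A => @dist_fclose_base _ _ _ d0 dE dC dT dN z A) Ucover.
have [M M0 sM] := common_bound cs.
have [e' e'0 he'] := separated_mixtures k M0 e0.
have cms f : f \in [seq mean f | f <- s] -> continuous f.
  by move=> /mapP[g gs ->]; apply: mean_continuous; exact: cs.
have [V Vcover Vs] := fine_cover Mcompact cms e'0.
exists V => // S n.
pose close z w := forall i, (0 < i <= n)%N ->
  fclose s e (a (S i) z) (a (S i) w).
have [x xsep] := @separated_family X (iterated_join a U S n) close
  (fun z w zw i i_n => fclose_sym (zw i i_n))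
  (fun z => iterated_join_lebesgue a S n z Us) point.
pose T := [set f | exists i g, [/\ (0 < i <= n)%N, g \in s & f = g \o a (S i)]].
have [|i j ij|K [mu [cK muK]]] := he' T _ x.
- move=> _ [i [g [_ gs ->]]]; split; last by move=> y; exact: (sM g gs).
  by move=> y; apply: continuous_comp; [exact: act_continuous|exact: cs].
- have /existsNP[l /not_implyP[l_n /existsNP[f /not_implyP[fs /negP]]]] :=
  xsep _ _ ij.
  rewrite -leNgt => h; exists (f \o a (S l)) => //.
  by exists l, f; split.
rewrite -[X in (X ^ _)%N]card_ord -cK.
have [Vf _ VT] := Vcover.
apply: (cover_number_ge (z := mu)).
- exact: iterated_join_finite.
- exact: iterated_join_cover.
- move=> A i j AV Ai Aj; apply/eqP; apply: contrapT => /negP ij.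
  have [_ [l [f [l_n fs ->]]]] := muK _ _ ij.
  rewrite leNgt => /negP; apply.
  have := iterated_join_fclose Vs AV Ai Aj l_n (map_f (@mean R X) fs).
  by rewrite /= !mean_pushforward//; exact: cs.
Qed.

End lower_bound.

(** * From M(X) to X *)

(** Partial codes: the recorded values will be the discretised integrals at the coordinates where
    the empirical average is inaccurate. *)
Definition sparse (E : finType) D b : {set {ffun E -> option 'I_D}} :=
  [set phi : {ffun E -> option 'I_D} |
    (#|[set x | phi x != None]%SET| <= b)%N]%SET.

(* Weighting phi by q to the number of its non-[None] values makes the total
   weight a product over E. *)
Lemma card_sparse (R : realType) (E : finType) D b (q : R) : 0 < q <= 1 ->
  #|sparse E D b|%:R * q ^+ b <= (1 + D%:R * q) ^+ #|E|.
Proof.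
move=> /andP[q0 q1].
pose w (o : option 'I_D) : R := if o is Some _ then q else 1.
have w_ge0 o : 0 <= w o by case: o => [?|]//=; exact: ltW.
have <- : \sum_(o : option 'I_D) w o = 1 + D%:R * q.
  rewrite (bigD1 None)//= (reindex_omap Some id)/=; last by case.
  under eq_bigl do rewrite eqxx.
  by rewrite sumr_const card_ord mulr_natl.
rewrite -prodr_const bigA_distr_bigA/= -sum1_card natr_sum mulr_suml.
rewrite [leRHS](bigID (mem (sparse E D b)))/=.
rewrite -[leLHS]addr0; apply: lerD; last first.
  by apply: sumr_ge0 => phi _; exact: prodr_ge0.
apply: ler_sum => phi; rewrite inE => phib; rewrite mul1r.
rewrite (bigID (fun x => phi x != None))/= [X in _ * X]big1 ?mulr1; last first.
  by move=> x /negPn/eqP ->.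
rewrite (eq_bigr (fun=> q)); last by move=> x; rewrite /w; case: (phi x).
rewrite prodr_const; apply: ler_wiXn2l => //; first exact: ltW.
by move: phib; rewrite cardsE.
Qed.

(** * Maurey's empirical method *)

Section empirical.
Context {R : realType} {X : ptopologicalType}.
Hypothesis Xcompact : compact [set: X].

(* The points are chosen greedily: the mean over x of the squared norm of
   S + g(x) - mean g is |S|^2 plus a variance, the cross term having mean 0. *)
Lemma empirical_approx (E : finType) (g : E -> X -> R) (M : R)
    (mu : borel_prob R X) (k : nat) :
    (forall e, continuous (g e)) -> (forall e x, `|g e x| <= M) ->
  exists x : nat -> X,
    \sum_e (\sum_(t < k) g e (x t) - k%:R * mean (g e) mu) ^+ 2 <=
      k%:R * (#|E|%:R * (2 * M) ^+ 2).
Proof.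
move=> cg gM; pose m e := mean (g e) mu.
have mM e : `|m e| <= M by exact: mean_bound.
elim: k => [|k [x xk]].
  exists (fun=> point); rewrite mul0r big1// => e _.
  by rewrite big_ord0 mul0r subr0 expr0n.
pose S e := \sum_(t < k) g e (x t) - k%:R * m e.
have cgm e : continuous (fun y => g e y - m e).
  by move=> y; apply: cvgB; [exact: cg|exact: cvg_cst].
pose h e y := S e ^+ 2 + (2 * S e * (g e y - m e)
  + (g e y - m e) * (g e y - m e)).
have c1 e : continuous (fun y => 2 * S e * (g e y - m e)).
  by move=> y; apply: cvgM; [exact: cvg_cst|exact: cgm].
have c2 e : continuous (fun y => (g e y - m e) * (g e y - m e)).
  by move=> y; apply: cvgM; exact: cgm.
have c12 e : continuous (fun y =>
  2 * S e * (g e y - m e) + (g e y - m e) * (g e y - m e)).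
  by move=> y; apply: cvgD; [exact: c1|exact: c2].
have ccst (c : R) : continuous (fun _ : X => c) by move=> y; exact: cvg_cst.
have ch e : continuous (h e).
  by move=> y; apply: cvgD; [exact: cvg_cst|exact: c12].
have csum : continuous (fun y => \sum_e h e y).
  by move=> y; apply: cvg_big => [|e _]; [exact: add_continuous|exact: ch].
have [y hy] := exists_le_mean Xcompact mu csum.
exists (fun t => if t == k then y else x t).
have -> : \sum_e (\sum_(t < k.+1) g e (if t == k :> nat then y else x t) -
    k.+1%:R * mean (g e) mu) ^+ 2 = \sum_e h e y.
  apply: eq_bigr => e _; rewrite big_ord_recr/= eqxx.
  under eq_bigr => t _ do rewrite ltn_eqF//.
  rewrite -/(m e) /h /S -natr1; ring.
apply: (le_trans hy); rewrite mean_sum//.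
rewrite -natr1 mulrDl mul1r.
apply: le_trans (lerD xk (lexx _)).
have -> : #|E|%:R * (2 * M) ^+ 2 = \sum_(e : E) (2 * M) ^+ 2.
  by rewrite sumr_const mulr_natl.
rewrite -big_split/=.
apply: ler_sum => e _; rewrite -/(m e) -/(S e).
rewrite /h meanD// mean_cst meanD// meanZ// meanB//
  mean_cst -/(m e) subrr mulr0 add0r.
rewrite lerD2l -[leRHS](mean_cst mu); apply: le_mean => // z.
rewrite -expr2 -[leLHS]real_normK ?num_real//; apply: lerXn2r.
- by rewrite nnegrE.
- by rewrite nnegrE mulr_ge0// (le_trans _ (mM e)).
- by rewrite (le_trans (ler_normB _ _))// mulr_natl mulr2n lerD.
Qed.

End empirical.

(** Cut the segment from [- M] to [M] into cells of length [e]. The default of [inord] can only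
    occur for values above [M], which are never compared. *)
Lemma truncn_quantize (R : realType) (M e : R) : 0 < e ->
  exists D (Q : R -> 'I_D), forall v w, `|v| <= M -> `|w| <= M -> Q v = Q w ->
    `|v - w| < e.
Proof.
move=> e0; pose t v := Num.truncn ((v + M) / e).
exists (t M).+1, (fun v => inord (t v)) => v w.
have tM u : `|u| <= M -> (t u < (t M).+1)%N.
  rewrite ler_norml => /andP[_ uM]; rewrite ltnS; apply: le_truncn.
  by rewrite ler_pM2r ?invr_gt0// lerD2r.
have tb u : `|u| <= M -> (t u)%:R <= (u + M) / e < (t u).+1%:R.
  rewrite ler_norml => /andP[Mu _]; apply: truncn_itv.
  by rewrite divr_ge0 ?(ltW e0)// -lerBlDr sub0r.
move=> vM wM /(congr1 val); rewrite /= !inordK ?tM// => tvw.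
have /andP[] := tb v vM; have /andP[] := tb w wM; rewrite tvw -natr1.
rewrite !ler_pdivlMr// !ltr_pdivrMr// => *.
rewrite ltr_norml; apply/andP; split; lra.
Qed.

(** * Coding measures by orbits of points *)

Section upper_bound.
Context {R : realType} {G : groupType} {X : ptopologicalType} (a : action G X).
Hypothesis Xcompact : compact [set: X].

(** A measure is coded by the members of a minimal subcover of the join over X that contain its [k]
    sample points, together with its discretised integrals at the bad coordinates. Measures with the
    same code have [e]-close integrals at all times up to [n], so they lie in one member of the join
    over M(X). *)
Lemma cover_number_pushforward_le_sparse (s : seq (X -> R)) (e M : R)
    (V : set (set (borel_prob R X))) (U : set (set X)) D (Q : R ->
      'I_D) k S n b :
    0 < e -> (0 < k)%N ->
    (forall f, f \in s -> continuous f) ->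
    (forall f, f \in s -> forall x, `|f x| <= M) ->
    (forall mu, exists2 A, V A &
       [set nu | fclose [seq mean f | f <- s] e mu nu] `<=` A) ->
    finite_open_cover U ->
    (forall A z w, U A -> A z -> A w -> fclose s (e / 8) z w) ->
    (forall v w, `|v| <= M -> `|w| <= M -> Q v = Q w -> `|v - w| < e) ->
    (size s * n)%:R * (2 * M) ^+ 2 < b.+1%:R * (k%:R * (e / 8) ^+ 2) ->
  (cover_number (iterated_join (pushforward_action R a) V S n) <=
   cover_number (iterated_join a U S n) ^ k *
   #|sparse ('I_(size s) * 'I_n)%type D b|)%N.
Proof.
move=> e0 k0 cs sM Vs [Uf _ UX] Us QM hb.
have e8 : 0 < e / 8 by rewrite divr_gt0.
have kR : 0 < k%:R :> R by rewrite ltr0n.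
set N := cover_number (iterated_join a U S n).
set P := sparse _ D b.
pose E : finType := ('I_(size s) * 'I_n)%type.
(* A coordinate is a test function and a time; the ordinal [p.2] starts at 0, the times at 1. *)
pose g (p : E) : X -> R := nth (fun=> 0) s p.1 \o a (S p.2.+1).
have gs (p : E) : nth (fun=> 0) s p.1 \in s by apply: mem_nth.
have cg p : continuous (g p).
  by move=> x; apply: continuous_comp; [exact: act_continuous|exact/cs/gs].
have gM p x : `|g p x| <= M by exact: (sM _ (gs p)).
have mgM p mu : `|mean (g p) mu| <= M by exact: mean_bound.
have [c cU cX] := cover_numberE (iterated_join_finite a S n Uf)
  (iterated_join_cover a S n UX).
pose err (x : nat -> X) mu p := \sum_(t < k) g p (x t) - k%:R * mean (g p) mu.
pose T : finType := ({ffun 'I_k -> 'I_N} * {phi | phi \in P})%type.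
(* [J.2] is [None] where the average over the k points is accurate. *)
pose code (J : T) : set (borel_prob R X) := [set mu | exists2 x : nat -> X,
  forall t : 'I_k, c (J.1 t) (x t) &
  forall p, if val J.2 p is Some i then Q (mean (g p) mu) = i
            else `|err x mu p| <= k%:R * (e / 8)].
have -> : (N ^ k * #|P|)%N = #|T|.
  by rewrite card_prod card_ffun !card_ord card_sig.
apply: (cover_number_le (c := code)) => [J|mu].
  (* A code that no measure has is contained in any member. Otherwise one measure [mu] with this
     code is fixed, and the others are compared with it. *)
  have [[mu [x xJ xmu]]|noJ] := pselect (code J !=set0); last first.
    have [mu] := @borel_prob_inhabited R X.
    have [A AV _] := iterated_join_lebesgue (pushforward_action R a) S n mu Vs.
    by exists A => // nu Jnu; exfalso; apply: noJ; exists nu.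
  have [A AV muA] := iterated_join_lebesgue (pushforward_action R a) S n mu Vs.
  exists A => // nu [y yJ ynu]; apply: muA => -[//|i] i_n _ /mapP[f fs ->].
  rewrite /= !mean_pushforward; try exact: cs.
  have lf : (index f s < size s)%N by rewrite index_mem.
  pose p : E := (Ordinal lf, Ordinal i_n).
  have -> : f \o a (S i.+1) = g p by rewrite /g/= nth_index.
  have := xmu p; have := ynu p; case: (val J.2 p) => [q <- xq|].
    exact: (QM _ _ (mgM _ _) (mgM _ _) xq).
  move=> ynup xmup.
  have gxy : `|\sum_(t < k) g p (x t) - \sum_(t < k) g p (y t)| <= k%:R * (e /
    8).
    rewrite -sumrB (le_trans (ler_norm_sum _ _ _))//.
    rewrite -[X in X%:R * _]card_ord mulr_natl -sumr_const;
      apply: ler_sum => t _.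
    by apply/ltW/(iterated_join_fclose Us (cU (J.1 t)) (xJ t) (yJ t) i_n);
      rewrite /= nth_index.
  (* Three errors of at most [k%:R * (e / 8)] add up: the two empirical ones and that between the
     two samples. *)
  have : `|k%:R * (mean (g p) mu - mean (g p) nu)| < k%:R * e.
    move: ynup xmup gxy; rewrite /err.
    set A1 := \sum_(t < k) g p (y t); set A2 := \sum_(t < k) g p (x t).
    have ke : 0 < k%:R * e by rewrite mulr_gt0.
    rewrite !ler_norml ltr_norml mulrBr (mulrA _ e) => *; lra.
  by rewrite normrM gtr0_norm// ltr_pM2l.
have [x xmu] := empirical_approx Xcompact mu k cg gM.
have /choice[J xJ] : forall t : 'I_k, exists j, c j (x t) by move=> t;
  exact: cX.
pose bad p := k%:R * (e / 8) < `|err x mu p|.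
pose phi := [ffun p : E => if bad p then Some (Q (mean (g p) mu)) else None].
(* Chebyshev's inequality: each bad coordinate contributes at least [(k%:R * (e / 8)) ^+ 2] to the
   total square error, so [hb] allows at most [b] of them. *)
have phiP : phi \in P.
  rewrite inE; set bads := [set x | _]%SET.
  have badsE p : p \in bads = bad p by rewrite inE ffunE; case: (bad p).
  rewrite -ltnS -(ltr_nat R).
  have k8 : 0 < k%:R * (e / 8) by rewrite mulr_gt0.
  rewrite -(@ltr_pM2r _ (k%:R * (e / 8) ^+ 2));
    last by rewrite mulr_gt0// exprn_gt0.
  apply: le_lt_trans hb; rewrite -(ler_pM2l kR).
  have <- : #|E| = (size s * n)%N by rewrite card_prod !card_ord.
  apply: le_trans xmu.
  have -> : k%:R * (#|bads|%:R * (k%:R * (e / 8) ^+ 2)) =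
      \sum_(p in bads) (k%:R * (e / 8)) ^+ 2.
    rewrite sumr_const -mulr_natl; ring.
  rewrite [leRHS](bigID (mem bads))/= -[leLHS]addr0; apply: lerD; last first.
    by apply: sumr_ge0 => p _; exact: sqr_ge0.
  apply: ler_sum => p; rewrite badsE => badp.
  by rewrite -[leRHS]real_normK ?num_real// lerXn2r ?nnegrE ?(ltW badp)// ltW.
exists ([ffun t => J t], exist _ phi phiP); exists x => [t|p].
  by rewrite ffunE.
by rewrite /= ffunE; case: ifPn => //; rewrite -leNgt.
Qed.

End upper_bound.

(** * Upper limits of extended real sequences *)

Section limsup.
Context {R : realType}.
Local Open Scope ereal_scope.

Lemma limn_esup_le_near (u : nat -> \bar R) c :
  (\forall n \near \oo, u n <= c) -> limn_esup u <= c.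
Proof.
move=> uc; apply: (@le_trans _ _ (ereal_sup (u @` [set n | u n <= c]))).
  by apply: ereal_inf_lbound; exists [set n | u n <= c].
by apply: ge_ereal_sup => _ [n + <-].
Qed.

Lemma limn_esup_lt_near (u : nat -> \bar R) c :
  limn_esup u < c -> \forall n \near \oo, u n < c.
Proof.
move=> /ereal_inf_lt[_ [V Voo <-] Vc]; apply: filterS Voo => n Vn.
by apply: le_lt_trans Vc; apply: ereal_sup_ubound; exists n.
Qed.

End limsup.

(** * Comparison of the sequence entropies *)

Section entropy.
Context {R : realType} {G : groupType} {X : ptopologicalType} (a : action G X).
Hypothesis Xcompact : compact [set: X].

(** Take logarithms in both inequalities and use [ln (1 + x) <= x]. The weight [q] remains free, to
    be chosen small before [k] and [b]. *)
Lemma ln_cover_number_le (NM NX Sp k b m D : nat) (q : R) :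
    (0 < NM)%N -> (0 < NX)%N -> (NM <= NX ^ k * Sp)%N -> 0 < q ->
    Sp%:R * q ^+ b <= (1 + D%:R * q) ^+ m ->
  ln NM%:R <= k%:R * ln NX%:R + b%:R * - ln q + m%:R * (D%:R * q).
Proof.
move=> NM0 NX0 NMle q0 Sple.
have Sp0 : (0 < Sp)%N.
  by rewrite lt0n; apply/eqP => Sp0; move: NMle; rewrite Sp0 muln0 leqNgt NM0.
have Dq : 0 <= D%:R * q by rewrite mulr_ge0// ltW.
have NX0R : 0 < NX%:R :> R by rewrite ltr0n.
have Sp0R : 0 < Sp%:R :> R by rewrite ltr0n.
have lnNM : ln NM%:R <= k%:R * ln NX%:R + ln Sp%:R :> R.
  have -> : k%:R * ln NX%:R + ln Sp%:R = ln (NX ^ k * Sp)%:R :> R.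
    by rewrite natrM natrX lnM ?posrE ?exprn_gt0// lnXn// mulr_natl.
  by rewrite ler_ln ?posrE ?ltr0n ?muln_gt0 ?expn_gt0 ?NX0// ler_nat.
have lnSp : ln Sp%:R + b%:R * ln q <= m%:R * (D%:R * q).
  have -> : ln Sp%:R + b%:R * ln q = ln (Sp%:R * q ^+ b).
    by rewrite lnM ?posrE ?exprn_gt0// lnXn// mulr_natl.
  apply: (@le_trans _ _ (ln ((1 + D%:R * q) ^+ m))).
    rewrite ler_ln ?posrE// ?mulr_gt0 ?exprn_gt0//.
    by rewrite ltr_pwDl.
  rewrite lnXn ?ltr_pwDl// -[leLHS]mulr_natl ler_wpM2l//; apply: le_ln1Dx.
  by rewrite (lt_le_trans _ Dq)// ltrN10.
rewrite mulrN; lra.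
Qed.

Lemma means_of (s : seq (borel_prob R X -> R)) :
    (forall f, f \in s -> [set mean g | g in [set g : X ->
      R | continuous g]] f) ->
  exists2 t : seq (X -> R), s = [seq mean g | g <- t] &
    forall g, g \in t -> continuous g.
Proof.
elim: s => [|f s ih] fs; first by exists [::].
have [|t st ct] := ih; first by move=> g gs; apply: fs; rewrite in_cons gs orbT.
have [g cg gf] := fs f (mem_head f s).
exists (g :: t); first by rewrite /= gf st.
by move=> h; rewrite in_cons => /predU1P[->//|/ct].
Qed.

(** The three terms of [ln_cover_number_le] are each made at most [eps / 3] times [n]: the last by
    the choice of [q], the second by that of [k], and the first, for large [n], by the vanishing
    entropy of X. *)
Lemma htop_seq_pushforward_le0 (S : nat -> G) (V : set (set (borel_prob R X))) :
    compact [set: borel_prob R X] -> finite_open_cover V ->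
    (forall U, finite_open_cover U -> (htop_seq R a U S <= 0)%E) ->
  (htop_seq R (pushforward_action R a) V S <= 0)%E.
Proof.
move=> Mcompact Vcover US.
have cmean f : [set mean g | g in [set g : X -> R | continuous g]] f ->
  continuous f.
  by move=> [g cg <-]; exact: mean_continuous.
have [s' [e [e0 /means_of[s -> cs] Vs]]] := lebesgue_fclose Mcompact cmean
  (fun mu A => @weak_star_fclose_base _ _ mu A) Vcover.
have [M M0 sM] := common_bound Xcompact cs.
have [D [Q QM]] := truncn_quantize M e0.
apply/lee_addgt0Pr => eps eps0; rewrite add0e.
pose L := size s.
have LD0 : 0 <= L%:R * D%:R :> R by rewrite mulr_ge0.
(* Chosen to give both [q <= 1] and [L%:R * D%:R * q <= eps / 3]. *)
pose q := eps / (eps + 3 * (L%:R * D%:R + 1)).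
have den0 : 0 < eps + 3 * (L%:R * D%:R + 1) by lra.
have q0 : 0 < q by rewrite divr_gt0.
have qE : q * (eps + 3 * (L%:R * D%:R + 1)) = eps by rewrite divfK// gt_eqF.
clearbody q.
have q1 : q <= 1 by nra.
have LDq : L%:R * D%:R * q <= eps / 3 by nra.
have p0 : 0 <= - ln q by rewrite oppr_ge0 ln_le0.
(* By Chebyshev, at most [n%:R * C / k%:R] coordinates are bad. *)
pose C := L%:R * (2 * M) ^+ 2 / (e / 8) ^+ 2.
have e8 : 0 < e / 8 by rewrite divr_gt0.
have C0 : 0 <= C by apply: divr_ge0; [apply: mulr_ge0|]; rewrite ?sqr_ge0.
(* With this many sample points, the bad coordinates cost at most [C * - ln q / k%:R <= eps / 3] per
   unit of time. *)
pose k := (Num.truncn (3 * C * - ln q / eps)).+1.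
have k0 : 0 < k%:R :> R by rewrite ltr0n.
have Ck : C * - ln q <= eps / 3 * k%:R.
  have := truncnS_gt (3 * C * - ln q / eps).
  rewrite -/k ltr_pdivrMr// => h; lra.
have [U Ucover Us] := fine_cover Xcompact cs e8.
(* The rate is divided by [k] because a code uses [k] members of the join over X. *)
have : (htop_seq R a U S < (eps / (3 * k%:R))%:E)%E.
  by apply: (le_lt_trans (US U Ucover)); rewrite lte_fin divr_gt0// mulr_gt0.
move=> /limn_esup_lt_near hX; apply: limn_esup_le_near.
near=> n.
have n0 : (0 < n)%N by near: n; exists 1%N.
have n0R : 0 < n%:R :> R by rewrite ltr0n.
have : ((n%:R^-1 * ln (cover_number (iterated_join a U S n))%:R)%:E <
  (eps / (3 * k%:R))%:E)%E by near: n.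
rewrite !lee_fin lte_fin ltr_pdivlMr ?mulr_gt0//
  !(mulrC n%:R^-1) ler_pdivrMr// => hn.
have {}hn : k%:R * ln (cover_number (iterated_join a U S n))%:R <= eps / 3 *
  n%:R.
  move: hn; set lnN := ln _ => hn.
  have : lnN / n%:R * (3 * k%:R) * n%:R = 3 * (k%:R * lnN).
    by field; rewrite gt_eqF.
  have : lnN / n%:R * (3 * k%:R) * n%:R < eps * n%:R by rewrite ltr_pM2r.
  lra.
pose b := Num.truncn (n%:R * C / k%:R).
have bC : b%:R * k%:R <= n%:R * C.
  rewrite -ler_pdivlMr// truncn_le; apply: divr_ge0; last exact: ltW.
  by apply: mulr_ge0 C0.
have hb : (size s * n)%:R * (2 * M) ^+ 2 < b.+1%:R * (k%:R * (e / 8) ^+ 2).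
  have := truncnS_gt (n%:R * C / k%:R); rewrite -/b ltr_pdivrMr// => h.
  have e82 : 0 < (e / 8) ^+ 2 by rewrite exprn_gt0.
  have : n%:R * C * (e / 8) ^+ 2 < b.+1%:R * k%:R * (e / 8) ^+ 2
    by rewrite ltr_pM2r.
  have -> : n%:R * C * (e / 8) ^+ 2 = (size s * n)%:R * (2 * M) ^+ 2.
    rewrite -mulrA /C divfK ?gt_eqF// natrM -/L; ring.
  by rewrite -mulrA.
have NMle := cover_number_pushforward_le_sparse (V := V) (k :=
  k) a Xcompact S e0 (ltn0Sn _) cs sM
  Vs Ucover Us QM hb.
have q01 : 0 < q <= 1 by rewrite q0.
have Sple := card_sparse ('I_(size s) * 'I_n)%type D b q01.
have [mu0] := @borel_prob_inhabited R X.
have NM0 : (0 < cover_number (iterated_join (pushforward_action R a) V S n))%N.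
  have [Vf _ VT] := Vcover; apply: (cover_number_gt0 mu0).
    exact: iterated_join_finite.
  exact: iterated_join_cover.
have NX0 : (0 < cover_number (iterated_join a U S n))%N.
  have [Uf _ UT] := Ucover; apply: (cover_number_gt0 point).
    exact: iterated_join_finite.
  exact: iterated_join_cover.
apply: (le_trans (ln_cover_number_le NM0 NX0 NMle q0 Sple)).
rewrite card_prod !card_ord natrM -/L.
have h1 : b%:R * - ln q <= eps / 3 * n%:R.
  rewrite -(ler_pM2r k0).
  have : b%:R * k%:R * - ln q <= n%:R * C * - ln q by rewrite ler_wpM2r.
  rewrite [b%:R * k%:R * _]mulrAC => /le_trans; apply.
  have -> : eps / 3 * n%:R * k%:R = n%:R * (eps / 3 * k%:R) by ring.
  by rewrite -mulrA ler_pM2l.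
have h2 : L%:R * n%:R * (D%:R * q) <= n%:R * (eps / 3).
  have -> : L%:R * n%:R * (D%:R * q) = n%:R * (L%:R * D%:R * q) by ring.
  by rewrite ler_pM2l.
apply: (le_trans (lerD (lerD hn h1) h2)).
by rewrite le_eqVlt; apply/orP; left; apply/eqP; field.
Unshelve. all: by end_near. Qed.

(** One cover [V] serves all [n], so the inequality between covering numbers passes to the upper
    limits. The exponent [k.+1] is positive and can be divided out. *)
Lemma htop_seq_pushforward_ge (S : nat ->
  G) (U : set (set X)) (k : nat) (c : R) :
    metrizable R X -> compact [set: borel_prob R X] -> finite_open_cover U ->
    (c%:E < htop_seq R a U S)%E ->
  exists2 V, finite_open_cover V &
    ((k.+1%:R * c)%:E <= htop_seq R (pushforward_action R a) V S)%E.
Proof.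
move=> hX Mcompact Ucover cU.
have [V Vcover VU] := cover_number_pushforward_ge Xcompact a k.+1 hX Mcompact
  Ucover.
exists V => //.
rewrite leNgt; apply/negP => /limn_esup_lt_near hM.
move: cU; rewrite ltNge => /negP; apply; apply: limn_esup_le_near.
apply: filterS hM => n; rewrite lte_fin lee_fin => hM.
rewrite -(@ler_pM2l _ k.+1%:R) ?ltr0n//; apply/ltW/le_lt_trans/hM.
rewrite mulrCA ler_wpM2l// ?invr_ge0//.
have NX0 : (0 < cover_number (iterated_join a U S n))%N.
  have [Uf _ UT] := Ucover; apply: (cover_number_gt0 point).
    exact: iterated_join_finite.
  exact: iterated_join_cover.
rewrite mulr_natl -lnXn ?ltr0n// -natrX ler_ln ?posrE ?ltr0n ?expn_gt0 ?NX0//.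
  by rewrite ler_nat.
by apply: leq_trans (VU S n); rewrite expn_gt0 NX0.
Qed.

End entropy.

Theorem theorem4p33 (R : realType) (G : groupType) (X : ptopologicalType)
    (a : action G X)
    (hGcount : countable [set: G]) (hGinf : infinite_set [set: G])
    (hXcomp : compact [set: X]) (hXmetr : metrizable R X) :
  ((0 < htop_star R a)%E <-> (0 < htop_star R (pushforward_action R a))%E) /\
  ((0 < htop_star R (pushforward_action R a))%E <->
     htop_star R (pushforward_action R a) = +oo%E).
Proof.
have Mcomp : compact [set: borel_prob R X].
  apply: borel_prob_compact => //; have [d [d0 dE dC dT dN]] := hXmetr.
  exact: (@dist_hausdorff _ _ d).
have X_infty : (0 < htop_star R a)%E ->
    htop_star R (pushforward_action R a) = +oo%E.
  move=> /ereal_sup_gt[_ [U Ucover [S _ <-]] hU].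
  (* A finite positive rate strictly below the entropy; 1 is taken if the entropy is infinite. *)
  have [c c0 cU] : exists2 c : R, 0 < c & (c%:E < htop_seq R a U S)%E.
    move: hU; case: (htop_seq R a U S) => [r| |]//.
      by rewrite lte_fin => r0; exists (r / 2); rewrite ?divr_gt0// lte_fin;
        lra.
    by exists 1; rewrite ?ltry.
  apply: eq_infty => A.
  (* With [k] the integer part of [A / c], the bound [k.+1%:R * c] exceeds [A]. *)
  have [V Vcover hV] :=
    htop_seq_pushforward_ge hXcomp (Num.truncn (A / c)) hXmetr Mcomp Ucover cU.
  apply: (@le_trans _ _ (htop_seq R (pushforward_action R a) V S)).
    apply: le_trans hV; rewrite lee_fin -ler_pdivrMr//.
    exact/ltW/truncnS_gt.
  by apply: ereal_sup_ubound; exists V => //; exists S.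
have M_pos_X : (0 < htop_star R (pushforward_action R a))%E ->
  (0 < htop_star R a)%E.
  (* By contraposition: if the supremum over X is at most 0, so is the entropy of every cover of X
     along each sequence. *)
  apply: contraTT; rewrite -!leNgt => hX.
  apply: ge_ereal_sup => _ [V Vcover [S _ <-]].
  apply: htop_seq_pushforward_le0 => // U Ucover; apply: le_trans hX.
  by apply: ereal_sup_ubound; exists U => //; exists S.
split; split.
- by move=> /X_infty ->; rewrite ltry.
- exact: M_pos_X.
- by move=> /M_pos_X/X_infty.
- by move=> ->; rewrite ltry.
Qed.
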